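(* Let $E$ be an arbitrary directed graph, $K$ a field and $L=L_K(E)$. Then the following are equivalent: (1) Every graded-simple left $L$-module is finitely presented; (2) $L$ is graded semi-simple, that is, $L$ is a direct sum of minimal graded left ideals; (3) The graph $E$ is row-finite and for each vertex $u$ there is an integer $n\geq 0$ such that every path beginning with $u$ and having length $\geq n$ ends at a line point or a Laurent vertex.
   Context: A directed graph $E=(E^0,E^1,r,s)$ has vertex set $E^0$, edge set $E^1$ and range/source maps $r,s$; no cardinality restriction is made. A path of length $n>0$ is a sequence of edges $\mu=e_1\cdots e_n$ with $r(e_i)=s(e_{i+1})$; vertices are paths of length $0$. A vertex is regular if it emits a nonempty finite set of edges; $E$ is row-finite if no vertex emits infinitely many edges. $L_K(E)$ is the (not necessarily unital) $K$-algebra generated by pairwise orthogonal idempotents $v\in E^0$ and elements $e,e^*$ ($e\in E^1$) subject to: $s(e)e=e=er(e)$; $r(e)e^*=e^*=e^*s(e)$; $e^*e=r(e)$ and $e^*f=0$ for $e\ne f$; $v=\sum_{s(e)=v}ee^*$ for each regular vertex $v$. It is $\mathbb{Z}$-graded by $\deg v=0$, $\deg e=1$, $\deg e^*=-1$. Since $L$ need not have an identity, left $L$-modules $M$ are understood to satisfy $LM=M$. A graded left module $M\neq0$ is graded-simple if $0$ and $M$ are its only graded submodules. A module is finitely presented if it is isomorphic to $P/N$ with $P$ a finitely generated projective module and $N$ finitely generated. A minimal graded left ideal is a nonzero graded left ideal containing no graded left ideals other than $0$ and itself. A cycle is a closed path $e_1\cdots e_n$ ($n\geq1$, $r(e_n)=s(e_1)$)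 with $s(e_i)\ne s(e_j)$ for $i\neq j$. An exit of a path $e_1\cdots e_n$ is an edge $f$ with $s(f)=s(e_i)$, $f\ne e_i$ for some $i$. For a vertex $v$, $T_E(v)$ is the set of vertices $w$ such that there is a path from $v$ to $w$. A bifurcation vertex is a vertex emitting more than one edge. A vertex $v$ is a line point if no vertex of $T_E(v)$ is a bifurcation vertex or the base of a cycle. A vertex $v$ is a Laurent vertex if $T_E(v)$ is the set of all vertices on a single path $\gamma=\mu c$, where $\mu$ is a path without bifurcations starting at $v$ and $c$ is a cycle without exits based at $r(\mu)$. *)

(* Defs.v *)
Set Warnings "-notation-overridden,-ambiguous-paths".
From HB Require Import structures.
From mathcomp Require Import all_boot all_order all_algebra.
From mathcomp Require Import finmap boolp classical_sets cardinality.

Set Implicit Arguments.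
Unset Strict Implicit.
Unset Printing Implicit Defensive.

Import GRing.Theory.
Local Open Scope classical_set_scope.
Local Open Scope ring_scope.
Local Open Scope quotient_scope.

Reserved Notation "x ** y" (at level 40, left associativity).
Reserved Notation "a **: x" (at level 40).

HB.mixin Record Zmodule_isNonUnitalRing A of GRing.Zmodule A := {
  nmul : A -> A -> A;
  nmulA : associative nmul;
  nmulDl : left_distributive nmul +%R;
  nmulDr : right_distributive nmul +%R
}.

#[short(type="nonUnitalRingType")]
HB.structure Definition NonUnitalRing :=
  {A of GRing.Zmodule A & Zmodule_isNonUnitalRing A}.

Notation "x ** y" := (nmul x y) : ring_scope.

(* act_full is the standing requirement R M = M, where R M is the additive    *)
(* subgroup generated by the products of an element of R and one of M.        *)
HB.mixin Record Zmodule_isFullModule (R : nonUnitalRingType) M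
    of GRing.Zmodule M := {
  act : R -> M -> M;
  actA : forall a b x, act a (act b x) = act (a ** b) x;
  actDl : forall a b x, act (a + b) x = act a x + act b x;
  actDr : forall a x y, act a (x + y) = act a x + act a y;
  act_full : forall x, exists s : seq (R * M), x = \sum_(p <- s) act p.1 p.2
}.

#[short(type="fullModType")]
HB.structure Definition FullModule (R : nonUnitalRingType) :=
  {M of GRing.Zmodule M & Zmodule_isFullModule R M}.

Notation "a **: x" := (act a x) : ring_scope.

Section Modules.
Variable R : nonUnitalRingType.
Implicit Types M P : fullModType R.

Definition is_subgroup (V : zmodType) (S : set V) : Prop :=
  S 0 /\ forall x y, S x -> S y -> S (x - y).

Definition is_submodule M (N : set M) : Prop :=
  is_subgroup N /\ forall (a : R) x, N x -> N (a **: x).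

Definition is_hom M M' (f : M -> M') : Prop :=
  (forall x y, f (x + y) = f x + f y) /\
  (forall (a : R) x, f (a **: x) = a **: f x).

Definition isomorphic M M' : Prop :=
  exists f : M -> M', is_hom f /\ bijective f.

(* The generated submodule is the smallest one containing the generators; it  *)
(* is the R-span of s as soon as R has local units, as Leavitt path algebras  *)
(* do.                                                                        *)
Definition fin_generated M (N : set M) : Prop :=
  exists s : seq M, [set` s] `<=` N /\
    forall N' : set M, is_submodule N' -> [set` s] `<=` N' -> N `<=` N'.

Definition projective P : Prop :=
  forall (A B : fullModType R) (g : A -> B) (f : P -> B),
    is_hom g -> (forall b, exists a, g a = b) -> is_hom f ->
    exists2 h : P -> A, is_hom h & forall x, g (h x) = f x.

Section QuotientModule.
Variables (M : fullModType R) (N : set M) (HN : is_submodule N).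

Definition submod_pred of is_submodule N : {pred M} := fun x => `[< N x >].
Local Notation Npred := (submod_pred HN).

Fact submod_pred_closed : zmod_closed Npred.
Proof.
have [[N0 NB] _] := HN; split; first exact/asboolP.
by move=> x y /asboolP Nx /asboolP Ny; apply/asboolP; exact: NB.
Qed.

HB.instance Definition _ := GRing.isZmodClosed.Build M Npred submod_pred_closed.

Definition quot_module : Type := Quotient.quot Npred.

HB.instance Definition _ := GRing.Zmodule.on quot_module.

Definition quot_proj (x : M) : quot_module := \pi_(Quotient.quot Npred) x.

Definition quot_act (a : R) (x : quot_module) : quot_module :=
  quot_proj (a **: repr (x : Quotient.quot Npred)).

Lemma quot_projP x y : quot_proj x = quot_proj y <-> N (x - y).
Proof.
rewrite /quot_proj; split.
  by move/eqP; rewrite -Quotient.idealrBE => /asboolP.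
by move=> Nxy; apply/eqP; rewrite -Quotient.idealrBE; apply/asboolP.
Qed.

Lemma quot_projD x y : quot_proj (x + y) = quot_proj x + quot_proj y.
Proof. exact: Quotient.pi_add. Qed.

Lemma quot_proj_surj (q : quot_module) : exists x, q = quot_proj x.
Proof. by exists (repr (q : Quotient.quot Npred)); rewrite /quot_proj reprK. Qed.

Lemma act_subr (a : R) (x y : M) : a **: (x - y) = a **: x - a **: y.
Proof. by apply/eqP; rewrite eq_sym subr_eq -actDr subrK. Qed.

Lemma quot_actE a x : quot_act a (quot_proj x) = quot_proj (a **: x).
Proof.
apply/quot_projP; rewrite -act_subr; apply: (proj2 HN).
by apply/quot_projP; rewrite /quot_proj reprK.
Qed.

Fact quot_actA a b x : quot_act a (quot_act b x) = quot_act (a ** b) x.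
Proof. by have [y ->] := quot_proj_surj x; rewrite !quot_actE actA. Qed.

Fact quot_actDl a b x : quot_act (a + b) x = quot_act a x + quot_act b x.
Proof. by have [y ->] := quot_proj_surj x; rewrite !quot_actE actDl quot_projD. Qed.

Fact quot_actDr a x y : quot_act a (x + y) = quot_act a x + quot_act a y.
Proof.
have [x' ->] := quot_proj_surj x; have [y' ->] := quot_proj_surj y.
by rewrite -quot_projD !quot_actE actDr quot_projD.
Qed.

Fact quot_act_full x : exists s : seq (R * quot_module),
  x = \sum_(p <- s) quot_act p.1 p.2.
Proof.
have [y ->] := quot_proj_surj x; have [s ->] := act_full (R := R) y.
exists [seq (p.1, quot_proj p.2) | p <- s]; rewrite big_map.
have quot_proj0 : quot_proj 0 = 0.
  by apply/(addrI (quot_proj 0)); rewrite -quot_projD !addr0.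
by rewrite (big_morph _ quot_projD quot_proj0); apply: eq_bigr => p _; rewrite quot_actE.
Qed.

HB.instance Definition _ := Zmodule_isFullModule.Build R quot_module
  quot_actA quot_actDl quot_actDr quot_act_full.

End QuotientModule.

Definition fin_presented M : Prop :=
  exists (P : fullModType R) (N : set P) (HN : is_submodule N),
    [/\ projective P, fin_generated [set: P], fin_generated N
      & isomorphic M (quot_module HN)].

End Modules.

(* The internal direct sum; meaningful when every S i is a subgroup of V.     *)
Definition is_direct_sum (V : zmodType) (I : choiceType) (S : I -> set V) : Prop :=
  (forall x, exists (s : seq I) (f : I -> V),
     [/\ uniq s, forall i, S i (f i) & x = \sum_(i <- s) f i]) /\
  (forall (s : seq I) (f : I -> V), uniq s -> (forall i, S i (f i)) ->
     \sum_(i <- s) f i = 0 -> forall i, i \in s -> f i = 0).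

Section Graded.
(* R_ n is the component of degree n of the Z-graded ring R. *)
Variables (R : nonUnitalRingType) (R_ : int -> set R).

Definition is_grading (M : fullModType R) (M_ : int -> set M) : Prop :=
  [/\ forall n, is_subgroup (M_ n), is_direct_sum M_
    & forall i j a x, R_ i a -> M_ j x -> M_ (i + j) (a **: x)].

Definition graded_submodule (M : fullModType R) (M_ : int -> set M) (N : set M) : Prop :=
  is_submodule N /\
  forall x, N x -> exists (s : seq int) (f : int -> M),
    [/\ uniq s, forall n, M_ n (f n) /\ N (f n) & x = \sum_(n <- s) f n].

Definition graded_simple (M : fullModType R) (M_ : int -> set M) : Prop :=
  (exists x : M, x <> 0) /\
  forall N : set M, graded_submodule M_ N -> N = [set 0] \/ N = [set: M].

End Graded.

(* Vertices and edges form arbitrary choiceTypes: classically, every type     *)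
(* carries such a structure.                                                  *)
Record graph := Graph {
  vertex : choiceType;
  edge : choiceType;
  src : edge -> vertex;
  rng : edge -> vertex
}.

Arguments src {g}.
Arguments rng {g}.

Section GraphTheory.
Variable E : graph.
Local Notation V := (vertex E).
Local Notation D := (edge E).
Implicit Types (u v w : V) (e f : D) (p c : seq D).

Definition emits v : set D := [set e | src e = v].

Definition regular v : Prop := emits v !=set0 /\ finite_set (emits v).

Definition row_finite : Prop := forall v, finite_set (emits v).

Definition composable : rel D := [rel e f | rng e == src f].

(* The start u of a path is recorded separately from its list of edges, so    *)
(* that [::] is the path of length 0 at u.                                    *)
Definition is_path u p : bool :=
  if p is e :: q then (src e == u) && path composable e q else true.

Definition path_end u p : V := last u (map rng p).

Definition path_vertices u p : seq V := u :: map rng p.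

(* mathcomp's cycle also requires the last edge to be composable with the     *)
(* first one.                                                                 *)
Definition is_cycle c : bool :=
  [&& c != [::], cycle composable c & uniq (map src c)].

Definition based_at c v : Prop := exists e q, c = e :: q /\ src e = v.

Definition is_exit p f : Prop := exists e, [/\ e \in p, src f = src e & f <> e].

Definition reachable v : set V :=
  [set w | exists p, is_path v p /\ path_end v p = w].

Definition bifurcation v : Prop := exists e f, [/\ src e = v, src f = v & e <> f].

Definition line_point v : Prop :=
  forall w, reachable v w ->
    ~ bifurcation w /\ ~ (exists c, is_cycle c /\ based_at c w).

(* mu is without bifurcations if none of its vertices, both ends included, is *)
(* a bifurcation vertex; its end lies on a cycle without exits anyway.        *)
Definition laurent_vertex v : Prop :=
  exists mu c : seq D,
    [/\ is_path v mu /\ (forall w, w \in path_vertices v mu -> ~ bifurcation w),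
        is_cycle c, forall f, ~ is_exit c f, based_at c (path_end v mu)
      & reachable v = [set` path_vertices v (mu ++ c)]].

End GraphTheory.

(* Formal expressions in the generators. The Leavitt path algebra is the      *)
(* quotient by lpa_rel below, the smallest congruence containing the laws of  *)
(* K-algebras without identity and the defining relations. Opposites are not  *)
(* a constructor: - x is (-1) x, which rel_scale0 makes an additive inverse.  *)

Inductive term (K : fieldType) (E : graph) : Type :=
| tVertex of vertex E
| tEdge of edge E
| tGhost of edge E
| tZero
| tAdd of term K E & term K E
| tScale of K & term K E
| tMul of term K E & term K E.

Arguments tVertex {K E}.
Arguments tEdge {K E}.
Arguments tGhost {K E}.
Arguments tZero {K E}.

Section Leavitt.
Variables (K : fieldType) (E : graph).
Local Notation T := (term K E).

HB.instance Definition _ := gen_eqMixin T.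
HB.instance Definition _ := gen_choiceMixin T.

Inductive lpa_rel : T -> T -> Prop :=
| rel_refl x : lpa_rel x x
| rel_sym x y : lpa_rel x y -> lpa_rel y x
| rel_trans x y z : lpa_rel x y -> lpa_rel y z -> lpa_rel x z
| rel_add x x' y y' :
    lpa_rel x x' -> lpa_rel y y' -> lpa_rel (tAdd x y) (tAdd x' y')
| rel_scale k x x' : lpa_rel x x' -> lpa_rel (tScale k x) (tScale k x')
| rel_mul x x' y y' :
    lpa_rel x x' -> lpa_rel y y' -> lpa_rel (tMul x y) (tMul x' y')
| rel_addA x y z : lpa_rel (tAdd x (tAdd y z)) (tAdd (tAdd x y) z)
| rel_addC x y : lpa_rel (tAdd x y) (tAdd y x)
| rel_add0 x : lpa_rel (tAdd tZero x) x
| rel_scale0 x : lpa_rel (tScale 0 x) tZero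
| rel_scale1 x : lpa_rel (tScale 1 x) x
| rel_scaleA k l x : lpa_rel (tScale k (tScale l x)) (tScale (k * l) x)
| rel_scaleDl k l x :
    lpa_rel (tScale (k + l) x) (tAdd (tScale k x) (tScale l x))
| rel_scaleDr k x y :
    lpa_rel (tScale k (tAdd x y)) (tAdd (tScale k x) (tScale k y))
| rel_mulA x y z : lpa_rel (tMul x (tMul y z)) (tMul (tMul x y) z)
| rel_mulDl x y z : lpa_rel (tMul (tAdd x y) z) (tAdd (tMul x z) (tMul y z))
| rel_mulDr x y z : lpa_rel (tMul x (tAdd y z)) (tAdd (tMul x y) (tMul x z))
| rel_scaleAl k x y : lpa_rel (tMul (tScale k x) y) (tScale k (tMul x y))
| rel_scaleAr k x y : lpa_rel (tMul x (tScale k y)) (tScale k (tMul x y))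
| rel_vv v : lpa_rel (tMul (tVertex v) (tVertex v)) (tVertex v)
| rel_vw v w : v <> w -> lpa_rel (tMul (tVertex v) (tVertex w)) tZero
| rel_src_edge e : lpa_rel (tMul (tVertex (src e)) (tEdge e)) (tEdge e)
| rel_edge_rng e : lpa_rel (tMul (tEdge e) (tVertex (rng e))) (tEdge e)
| rel_rng_ghost e : lpa_rel (tMul (tVertex (rng e)) (tGhost e)) (tGhost e)
| rel_ghost_src e : lpa_rel (tMul (tGhost e) (tVertex (src e))) (tGhost e)
| rel_ghost_edge e : lpa_rel (tMul (tGhost e) (tEdge e)) (tVertex (rng e))
| rel_ghost_edge0 e f : e <> f -> lpa_rel (tMul (tGhost e) (tEdge f)) tZero
| rel_regular v : regular v ->
    lpa_rel (tVertex v)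
      (\big[@tAdd K E/tZero]_(e <- fset_set (emits v)) tMul (tEdge e) (tGhost e)).

Definition lpa_relb : rel T := fun x y => `[< lpa_rel x y >].

Fact lpa_relb_equiv : equiv_class_of lpa_relb.
Proof.
split=> [x|x y|y x z]; first exact/asboolP/rel_refl.
  by apply/asboolP/asboolP; exact: rel_sym.
by move=> /asboolP xy /asboolP yz; apply/asboolP; exact: rel_trans yz.
Qed.

Canonical lpa_equiv := EquivRelPack lpa_relb_equiv.

Definition lpa : Type := {eq_quot lpa_equiv}.

HB.instance Definition _ := Choice.on lpa.

Definition lpa_pi (x : T) : lpa := \pi_{eq_quot lpa_equiv} x.
Definition lpa_repr (x : lpa) : T := repr (x : {eq_quot lpa_equiv}).

Lemma lpa_piP x y : lpa_pi x = lpa_pi y <-> lpa_rel x y.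
Proof. by split => [/eqmodP/asboolP|xy] //; apply/eqmodP/asboolP. Qed.

Lemma lpa_reprK x : lpa_pi (lpa_repr x) = x.
Proof. exact: reprK. Qed.

Definition lpa_vertex (v : vertex E) : lpa := lpa_pi (tVertex v).
Definition lpa_edge (e : edge E) : lpa := lpa_pi (tEdge e).
Definition lpa_ghost (e : edge E) : lpa := lpa_pi (tGhost e).
Definition lpa_zero : lpa := lpa_pi tZero.
Definition lpa_add (x y : lpa) : lpa := lpa_pi (tAdd (lpa_repr x) (lpa_repr y)).
Definition lpa_scale (k : K) (x : lpa) : lpa := lpa_pi (tScale k (lpa_repr x)).
Definition lpa_opp (x : lpa) : lpa := lpa_scale (-1) x.
Definition lpa_mul (x y : lpa) : lpa := lpa_pi (tMul (lpa_repr x) (lpa_repr y)).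

Lemma rel_repr_pi x : lpa_rel (lpa_repr (lpa_pi x)) x.
Proof. by apply/lpa_piP; rewrite lpa_reprK. Qed.

Lemma lpa_piD x y : lpa_add (lpa_pi x) (lpa_pi y) = lpa_pi (tAdd x y).
Proof. by apply/lpa_piP/rel_add; exact: rel_repr_pi. Qed.

Lemma lpa_piZ k x : lpa_scale k (lpa_pi x) = lpa_pi (tScale k x).
Proof. by apply/lpa_piP/rel_scale; exact: rel_repr_pi. Qed.

Lemma lpa_piM x y : lpa_mul (lpa_pi x) (lpa_pi y) = lpa_pi (tMul x y).
Proof. by apply/lpa_piP/rel_mul; exact: rel_repr_pi. Qed.

Let piE := (lpa_piD, lpa_piZ, lpa_piM).

Fact lpa_addA : associative lpa_add.
Proof.
move=> x y z; rewrite -[x]lpa_reprK -[y]lpa_reprK -[z]lpa_reprK !piE.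
exact/lpa_piP/rel_addA.
Qed.

Fact lpa_addC : commutative lpa_add.
Proof.
by move=> x y; rewrite -[x]lpa_reprK -[y]lpa_reprK !piE; exact/lpa_piP/rel_addC.
Qed.

Fact lpa_add0 : left_id lpa_zero lpa_add.
Proof. by move=> x; rewrite -[x]lpa_reprK !piE; exact/lpa_piP/rel_add0. Qed.

Fact lpa_addN : left_inverse lpa_zero lpa_opp lpa_add.
Proof.
move=> x; rewrite -[x]lpa_reprK /lpa_opp !piE; apply/lpa_piP.
set t := lpa_repr x.
apply: (rel_trans (y := tAdd (tScale (-1) t) (tScale 1 t))).
  by apply: rel_add; [exact: rel_refl | exact/rel_sym/rel_scale1].
apply: (rel_trans (rel_sym (rel_scaleDl _ _ _))).
by rewrite addNr; exact: rel_scale0.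
Qed.

HB.instance Definition _ :=
  GRing.isZmodule.Build lpa lpa_addA lpa_addC lpa_add0 lpa_addN.

Fact lpa_mulA : associative lpa_mul.
Proof.
move=> x y z; rewrite -[x]lpa_reprK -[y]lpa_reprK -[z]lpa_reprK !piE.
exact/lpa_piP/rel_mulA.
Qed.

Fact lpa_mulDl : left_distributive lpa_mul lpa_add.
Proof.
move=> x y z; rewrite -[x]lpa_reprK -[y]lpa_reprK -[z]lpa_reprK !piE.
exact/lpa_piP/rel_mulDl.
Qed.

Fact lpa_mulDr : right_distributive lpa_mul lpa_add.
Proof.
move=> x y z; rewrite -[x]lpa_reprK -[y]lpa_reprK -[z]lpa_reprK !piE.
exact/lpa_piP/rel_mulDr.
Qed.

HB.instance Definition _ :=
  Zmodule_isNonUnitalRing.Build lpa lpa_mulA lpa_mulDl lpa_mulDr.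

Fact lpa_scaleA k l x : lpa_scale k (lpa_scale l x) = lpa_scale (k * l) x.
Proof. by rewrite -[x]lpa_reprK !piE; exact/lpa_piP/rel_scaleA. Qed.

Fact lpa_scale1 : left_id 1 lpa_scale.
Proof. by move=> x; rewrite -[x]lpa_reprK !piE; exact/lpa_piP/rel_scale1. Qed.

Fact lpa_scaleDr : right_distributive lpa_scale lpa_add.
Proof.
move=> k x y; rewrite -[x]lpa_reprK -[y]lpa_reprK !piE.
exact/lpa_piP/rel_scaleDr.
Qed.

Fact lpa_scaleDl x : {morph lpa_scale^~ x : k l / k + l >-> lpa_add k l}.
Proof.
by move=> k l; rewrite -[x]lpa_reprK !piE; exact/lpa_piP/rel_scaleDl.
Qed.

HB.instance Definition _ := GRing.Zmodule_isLmodule.Build K lpa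
  lpa_scaleA lpa_scale1 lpa_scaleDr lpa_scaleDl.

Lemma lpa_scaleAl (k : K) (x y : lpa) : (k *: x) ** y = k *: (x ** y).
Proof.
rewrite -[x]lpa_reprK -[y]lpa_reprK.
rewrite [LHS](_ : _ = lpa_pi (tMul (tScale k (lpa_repr x)) (lpa_repr y))).
  rewrite [RHS](_ : _ = lpa_pi (tScale k (tMul (lpa_repr x) (lpa_repr y)))).
    exact/lpa_piP/rel_scaleAl.
  by rewrite -!piE.
by rewrite -!piE.
Qed.

Lemma lpa_full (x : lpa) : exists s : seq (lpa * lpa),
  x = \sum_(p <- s) p.1 ** p.2.
Proof.
rewrite -[x]lpa_reprK; elim: (lpa_repr x) => {x} [v|e|e||x [s xE] y [t yE]|k x [s xE]|x _ y _].
- exists [:: (lpa_vertex v, lpa_vertex v)]; rewrite big_seq1.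
  by rewrite [RHS]lpa_piM; exact/lpa_piP/rel_sym/rel_vv.
- exists [:: (lpa_vertex (src e), lpa_edge e)]; rewrite big_seq1.
  by rewrite [RHS]lpa_piM; exact/lpa_piP/rel_sym/rel_src_edge.
- exists [:: (lpa_vertex (rng e), lpa_ghost e)]; rewrite big_seq1.
  by rewrite [RHS]lpa_piM; exact/lpa_piP/rel_sym/rel_rng_ghost.
- by exists [::]; rewrite big_nil.
- by exists (s ++ t); rewrite big_cat /= -xE -yE -lpa_piD.
- exists [seq (k *: p.1, p.2) | p <- s]; rewrite big_map -lpa_piZ xE.
  rewrite [LHS](_ : _ = k *: \sum_(p <- s) p.1 ** p.2) // scaler_sumr.
  by apply: eq_bigr => p _; rewrite lpa_scaleAl.
- by exists [:: (lpa_pi x, lpa_pi y)]; rewrite big_seq1 [RHS]lpa_piM.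
Qed.

HB.instance Definition _ := Zmodule_isFullModule.Build lpa lpa
  (nmulA (s := lpa)) (fun a b x => nmulDl a b x) (fun a x y => nmulDr a x y) lpa_full.

(* The component of degree n: the smallest family of K-subspaces containing   *)
(* v, e, e* in degrees 0, 1, -1 and multiplicative in the degree.             *)
Inductive lpa_deg : int -> lpa -> Prop :=
| deg_vertex v : lpa_deg 0 (lpa_vertex v)
| deg_edge e : lpa_deg 1 (lpa_edge e)
| deg_ghost e : lpa_deg (-1) (lpa_ghost e)
| deg_zero n : lpa_deg n 0
| deg_add n x y : lpa_deg n x -> lpa_deg n y -> lpa_deg n (x + y)
| deg_scale n (k : K) x : lpa_deg n x -> lpa_deg n (k *: x)
| deg_mul m n x y : lpa_deg m x -> lpa_deg n y -> lpa_deg (m + n) (x ** y).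

Definition graded_left_ideal (I : set lpa) : Prop :=
  graded_submodule (R := lpa) (M := lpa) lpa_deg I.

Definition minimal_graded_left_ideal (I : set lpa) : Prop :=
  [/\ graded_left_ideal I, I <> [set 0]
    & forall J : set lpa, graded_left_ideal J -> J `<=` I ->
        J = [set 0] \/ J = I].

Definition graded_semisimple : Prop :=
  exists (X : choiceType) (I : X -> set lpa),
    (forall x, minimal_graded_left_ideal (I x)) /\ is_direct_sum I.

End Leavitt.

(* Main.v *)
Require Import Defs.
From mathcomp Require Import all_boot all_order all_algebra.
From mathcomp Require Import finmap boolp classical_sets functions cardinality.
From mathcomp Require Import zify.

Set Implicit Arguments.
Unset Strict Implicit.
Unset Printing Implicit Defensive.

Import GRing.Theory.

(** The implications are proved in a cycle: graded-simple modules finitely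
    presented, then the graph condition, then semisimplicity, then finite
    presentation again.

    The two kinds of vertices in the graph condition have a common description:
    [v] is a line point or a Laurent vertex exactly when no vertex reachable
    from [v] is a bifurcation ([unbranchedP]).  The computation behind
    everything else is [homogeneous_cancel].  A homogeneous element is a
    combination of products [p g^*] of a path and a ghost path, with
    [size p - size g] constant; multiplying it on the right by a path [q] that
    is longer than all the [g] absorbs the ghosts and leaves a combination of
    distinct paths of one length.  As [p^* p' = 0] for distinct [p] and [p'] of
    the same length, such a combination is zero or can be multiplied on the
    left into a vertex.

    From the graph to semisimplicity: below an unbranched [w] each vertex emits
    at most one edge, so [w = q q^*] for paths [q] from [w] that are as long as
    desired or end at a sink, and the cancellation shows that [L w] is a minimal
    graded left ideal.  If all long enough paths from [u] end at unbranched
    vertices, iterating [u = sum e e^*] writes [u] as a finite sum of orthogonal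
    idempotents [p p^*] with [L p p^*] minimal, and these idempotents for all
    [u] decompose [L] ([eventually_unbranched_semisimple]).

    From semisimplicity to finite presentation: a graded-simple [M] contains a
    homogeneous [m] and a minimal graded left ideal [I] with [I m <> 0].  Then
    [b |-> b m] is a bijection from [I] onto [M], and this makes [M] cyclic and
    projective ([semisimple_fin_presented]).

    From finite presentation to the graph: suppose that the [z i] are nonzero
    homogeneous elements of [u L] with a directed system of left annihilators,
    and that each homogeneous [y] either kills some [z i] or has some [z i] as
    a left multiple of [y z i].  The union [N] of the annihilators gives a
    graded-simple module [L / N], and if this is finitely presented then the
    annihilators stabilize ([fin_presented_annihilator_stable]).  At an infinite
    emitter [v] the elements [v - sum e e^*], for finite sets of edges leaving
    [v], violate this; so [E] is row-finite.  If branching never stops below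
    [u], then by the lemma of König some infinite path from [u] has infinitely
    many bifurcations, and its initial segments violate it too.

    That vertices do not vanish in [L] and that the grading is a direct sum are
    read off from two explicit representations of [L]
    ([lpa_vertex_neq0], [lpa_deg_independent]). *)

(** * Paths and ghost paths in a Leavitt path algebra *)

Section NonUnitalRingTheory.
Local Open Scope ring_scope.
Variable R : nonUnitalRingType.
Implicit Types a b c : R.

Lemma nmulr0 a : a ** 0 = 0.
Proof. by apply: (addrI (a ** 0)); rewrite -nmulDr !addr0. Qed.

Lemma nmul0r a : 0 ** a = 0.
Proof. by apply: (addrI (0 ** a)); rewrite -nmulDl !addr0. Qed.

Lemma nmulBr a b c : a ** (b - c) = a ** b - a ** c.
Proof. by apply/eqP; rewrite eq_sym subr_eq -nmulDr subrK. Qed.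

Lemma nmulBl a b c : (a - b) ** c = a ** c - b ** c.
Proof. by apply/eqP; rewrite eq_sym subr_eq -nmulDl subrK. Qed.

Lemma nmul_sumr (I : Type) (s : seq I) (F : I -> R) a :
  a ** (\sum_(i <- s) F i) = \sum_(i <- s) a ** F i.
Proof. exact: (big_morph _ (nmulDr a) (nmulr0 a)). Qed.

Lemma nmul_suml (I : Type) (s : seq I) (F : I -> R) a :
  (\sum_(i <- s) F i) ** a = \sum_(i <- s) F i ** a.
Proof.
by apply: (big_morph (fun x => x ** a)) => [x y|]; rewrite ?nmulDl ?nmul0r.
Qed.

Variable M : fullModType R.
Implicit Types x y : M.

Lemma act0r a : a **: (0 : M) = 0.
Proof. by rewrite -{1}(subrr (0 : M)) act_subr subrr. Qed.

Lemma act0l x : (0 : R) **: x = 0.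
Proof. by apply: (addrI ((0 : R) **: x)); rewrite -actDl !addr0. Qed.

Lemma act_subl a b x : (a - b) **: x = a **: x - b **: x.
Proof. by apply/eqP; rewrite eq_sym subr_eq -actDl subrK. Qed.

Lemma act_sumr (I : Type) (s : seq I) (F : I -> M) a :
  a **: (\sum_(i <- s) F i) = \sum_(i <- s) a **: F i.
Proof. exact: (big_morph _ (actDr a) (act0r a)). Qed.

Lemma act_suml (I : Type) (s : seq I) (F : I -> R) x :
  (\sum_(i <- s) F i) **: x = \sum_(i <- s) F i **: x.
Proof.
by apply: (big_morph (fun a => a **: x)) => [a b|]; rewrite ?actDl ?act0l.
Qed.

End NonUnitalRingTheory.

Section LeavittPaths.
Local Open Scope ring_scope.
Variables (K : fieldType) (E : graph).
Local Notation L := (lpa K E).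
Local Notation vx := (@lpa_vertex K E).
Local Notation ed := (@lpa_edge K E).
Local Notation gh := (@lpa_ghost K E).
Implicit Types (a b y z : L) (u v w x : vertex E) (e f : edge E).
Implicit Types (p q : seq (edge E)) (k : K).

Lemma lpa_scaleAr k a b : a ** (k *: b) = k *: (a ** b).
Proof.
rewrite -[a]lpa_reprK -[b]lpa_reprK.
rewrite [LHS](_ : _ = lpa_pi (tMul (lpa_repr a) (tScale k (lpa_repr b)))).
  rewrite [RHS](_ : _ = lpa_pi (tScale k (tMul (lpa_repr a) (lpa_repr b)))).
    exact/lpa_piP/rel_scaleAr.
  by rewrite -lpa_piZ -lpa_piM.
by rewrite -lpa_piM -lpa_piZ.
Qed.

Lemma mul_vertex_vertex v w : vx v ** vx w = if v == w then vx v else 0.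
Proof.
rewrite [LHS]lpa_piM; case: eqVneq => [<-|/eqP vw].
  exact/lpa_piP/rel_vv.
exact/lpa_piP/rel_vw.
Qed.

Lemma mul_vertex_edge v e : vx v ** ed e = if v == src e then ed e else 0.
Proof.
have eE : vx (src e) ** ed e = ed e.
  by rewrite [LHS]lpa_piM; exact/lpa_piP/rel_src_edge.
case: eqVneq => [->//|vs]; rewrite -eE nmulA mul_vertex_vertex.
by rewrite (negbTE vs) nmul0r.
Qed.

Lemma mul_edge_vertex v e : ed e ** vx v = if v == rng e then ed e else 0.
Proof.
have eE : ed e ** vx (rng e) = ed e.
  by rewrite [LHS]lpa_piM; exact/lpa_piP/rel_edge_rng.
case: eqVneq => [->//|vs]; rewrite -eE -nmulA mul_vertex_vertex.
by rewrite eq_sym (negbTE vs) nmulr0.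
Qed.

Lemma mul_vertex_ghost v e : vx v ** gh e = if v == rng e then gh e else 0.
Proof.
have eE : vx (rng e) ** gh e = gh e.
  by rewrite [LHS]lpa_piM; exact/lpa_piP/rel_rng_ghost.
case: eqVneq => [->//|vs]; rewrite -eE nmulA mul_vertex_vertex.
by rewrite (negbTE vs) nmul0r.
Qed.

Lemma mul_ghost_vertex v e : gh e ** vx v = if v == src e then gh e else 0.
Proof.
have eE : gh e ** vx (src e) = gh e.
  by rewrite [LHS]lpa_piM; exact/lpa_piP/rel_ghost_src.
case: eqVneq => [->//|vs]; rewrite -eE -nmulA mul_vertex_vertex.
by rewrite eq_sym (negbTE vs) nmulr0.
Qed.

Lemma mul_ghost_edge e f : gh e ** ed f = if e == f then vx (rng e) else 0.
Proof.
rewrite [LHS]lpa_piM; case: eqVneq => [<-|/eqP ef].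
  exact/lpa_piP/rel_ghost_edge.
exact/lpa_piP/rel_ghost_edge0.
Qed.

Lemma regular_vertexE v : regular v ->
  vx v = \sum_(e <- fset_set (emits v)) ed e ** gh e.
Proof.
move=> vreg; rewrite [LHS](proj2 (lpa_piP _ _) (rel_regular K vreg)).
rewrite (big_morph (@lpa_pi K E) (fun s t => esym (lpa_piD s t)) (erefl _)).
by apply: eq_bigr => e _; rewrite -lpa_piM.
Qed.

(** The path [q] ending at [x], as an element of the algebra, and below it the
    ghost path [q^*].  Recording the end rather than the start of a path makes
    sense of [q = [::]]; when [q] is not a path ending at [x], the monomial is
    automatically zero, so that no well-formedness hypothesis is carried
    around. *)
Definition path_mono x q : L := foldr (fun e a => ed e ** a) (vx x) q.

Definition ghost_mono x q : L := foldr (fun e a => a ** gh e) (vx x) q.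

Definition path_start x q := if q is e :: _ then src e else x.

Lemma mul_vertex_path v x q :
  vx v ** path_mono x q = if v == path_start x q then path_mono x q else 0.
Proof.
case: q => [|e q] /=; first by rewrite mul_vertex_vertex; case: eqVneq => [->|].
by rewrite nmulA mul_vertex_edge; case: ifP => _; rewrite ?nmul0r.
Qed.

Lemma mul_path_vertex x q : path_mono x q ** vx x = path_mono x q.
Proof.
elim: q => [|e q IHq] /=; first by rewrite mul_vertex_vertex eqxx.
by rewrite -nmulA IHq.
Qed.

Lemma mul_vertex_ghost_mono v x q :
  vx v ** ghost_mono x q = if v == x then ghost_mono x q else 0.
Proof.
elim: q => [|e q IHq] /=; first by rewrite mul_vertex_vertex; case: eqVneq => [->|].
by rewrite nmulA IHq; case: ifP => _; rewrite ?nmul0r.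
Qed.

Lemma mul_path_path v x p q :
  path_mono v p ** path_mono x q =
  if v == path_start x q then path_mono x (p ++ q) else 0.
Proof.
elim: p => [|e p IHp] /=; first by rewrite mul_vertex_path.
by rewrite -nmulA IHp; case: ifP => _; rewrite ?nmulr0.
Qed.

Lemma mul_ghost_ghost_mono e x q :
  gh e ** ghost_mono x q = if x == src e then ghost_mono (rng e) (rcons q e) else 0.
Proof.
elim: q => [|f q IHq] /=.
  by rewrite mul_ghost_vertex mul_vertex_ghost eqxx.
by rewrite nmulA IHq; case: ifP => _; rewrite ?nmul0r.
Qed.

(** Of two composable monomials [g^* b] with [g] no longer than [b], the ghost
    part cancels completely or kills the product. *)
Lemma mul_ghost_path v x p q : (size p <= size q)%N ->
  ghost_mono v p ** path_mono x q = 0 \/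
  ghost_mono v p ** path_mono x q = path_mono x (drop (size p) q).
Proof.
elim: p q => [|e p IHp] [|f q] //= le_pq.
- by rewrite mul_vertex_vertex; case: eqVneq => [->|_]; [right|left].
- by rewrite -[ed f ** _]/(path_mono x (f :: q)) mul_vertex_path; case: ifP; [right|left].
rewrite -nmulA (nmulA (gh e)) mul_ghost_edge; case: eqVneq => [->|_]; last first.
  by rewrite nmul0r nmulr0; left.
rewrite mul_vertex_path; case: ifP => _; last by rewrite nmulr0; left.
exact: IHp.
Qed.

Lemma ghost_path_orthogonal v x p q : size p = size q -> p <> q ->
  ghost_mono v p ** path_mono x q = 0.
Proof.
elim: p q => [|e p IHp] [|f q] //= [sz_pq] neq.
rewrite -nmulA (nmulA (gh e)) mul_ghost_edge.
case: eqVneq neq => [->|_ _]; last by rewrite nmul0r nmulr0.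
move=> neq; rewrite mul_vertex_path; case: ifP => _; last by rewrite nmulr0.
by apply: IHp => // pq; apply: neq; rewrite pq.
Qed.

Lemma ghost_path_self x q :
  path_mono x q = 0 \/ ghost_mono x q ** path_mono x q = vx x.
Proof.
elim: q => [|e q IHq] /=; first by rewrite mul_vertex_vertex eqxx; right.
rewrite -nmulA (nmulA (gh e)) mul_ghost_edge eqxx mul_vertex_path.
case: eqVneq => [_|neq].
  by case: IHq => [->|->]; [left; rewrite nmulr0 | right].
left; rewrite -[ed e](_ : ed e ** vx (rng e) = _); last first.
  by rewrite mul_edge_vertex eqxx.
by rewrite -nmulA mul_vertex_path (negbTE neq) nmulr0.
Qed.

Lemma path_ghost_path x q :
  path_mono x q ** (ghost_mono x q ** path_mono x q) = path_mono x q.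
Proof.
by case: (ghost_path_self x q) => [->|->]; rewrite ?nmul0r ?mul_path_vertex.
Qed.

(** Distinct paths of the same length are orthogonal for [(p, q) |-> p^* q], so
    a combination of them has a left inverse up to the end vertex as soon as
    one coefficient survives. *)
Lemma path_comb_cancel x (l : nat) (s : seq (K * seq (edge E))) :
    (forall t, t \in s -> size t.2 = l) ->
  let z := \sum_(t <- s) t.1 *: path_mono x t.2 in
  z = 0 \/ exists b, b ** z = vx x.
Proof.
move=> sz_s z; set qs := undup (map snd s).
have zE : z = \sum_(q <- qs) path_mono x q ** (ghost_mono x q ** z).
  rewrite [in RHS]/z; under [RHS]eq_bigr do rewrite !nmul_sumr.
  rewrite exchange_big /z !big_seq; apply: eq_bigr => t ts.
  rewrite (bigD1_seq t.2) ?undup_uniq ?mem_undup ?map_f //=.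
  rewrite big_seq_cond big1 => [|q /andP[]].
    by rewrite addr0 !lpa_scaleAr path_ghost_path.
  rewrite mem_undup => /mapP[t' t's ->] neq.
  rewrite !lpa_scaleAr ghost_path_orthogonal ?nmulr0 ?scaler0 ?sz_s //.
  exact/eqP.
case: (pselect (exists2 q, q \in qs & ghost_mono x q ** z <> 0)) => [[q qqs gz]|none].
  right; have [c cE] : exists c : K, ghost_mono x q ** z = c *: vx x.
    have : forall t, t \in s -> exists c : K, ghost_mono x q ** path_mono x t.2 = c *: vx x.
      move=> t ts; case: (eqVneq q t.2) => [->|neq].
        case: (ghost_path_self x t.2) => [->|->]; last by exists 1; rewrite scale1r.
        by exists 0; rewrite nmulr0 scale0r.
      exists 0; rewrite scale0r ghost_path_orthogonal //; last exact/eqP.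
      move: qqs; rewrite mem_undup => /mapP[t' t's ->].
      by rewrite !sz_s.
    move=> scal; rewrite /z nmul_sumr; elim: (s) scal => [|t s' IHs] scal.
      by exists 0; rewrite big_nil scale0r.
    have [c cE] : exists c, \sum_(i <- s') ghost_mono x q ** (i.1 *: path_mono x i.2)
        = c *: vx x by apply: IHs => i i_s; apply: scal; rewrite inE i_s orbT.
    have [d dE] := scal t (mem_head _ _).
    exists (t.1 * d + c); rewrite big_cons cE lpa_scaleAr dE scalerA.
    by rewrite -scalerDl.
  have c0 : c != 0 by apply/eqP => c0; apply: gz; rewrite cE c0 scale0r.
  exists (c^-1 *: ghost_mono x q).
  by rewrite lpa_scaleAl cE scalerA mulVf // scale1r.
left; rewrite zE big_seq big1 // => q qqs.
by have [->|/eqP gz] := eqVneq (ghost_mono x q ** z) 0; [rewrite nmulr0 | case: none; exists q].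
Qed.

(** * Homogeneous elements *)

(** The combinations of the [p q^*] with [size p - size q = n].  The lengths
    are compared in [int] and without subtraction, so that no truncation
    occurs. *)
Inductive homog_form (n : int) : L -> Prop :=
| homog_form0 : homog_form n 0
| homog_formD k x p q y : (size p)%:Z = n + (size q)%:Z -> homog_form n y ->
    homog_form n (k *: (path_mono x p ** ghost_mono x q) + y).

Lemma homog_form_add n y z : homog_form n y -> homog_form n z -> homog_form n (y + z).
Proof.
move=> + nz; elim=> [|k x p q y' sz_pq _ IHy]; first by rewrite add0r.
by rewrite -addrA; apply: homog_formD.
Qed.

Lemma homog_form_scale n k y : homog_form n y -> homog_form n (k *: y).
Proof.
elim=> [|l x p q y' sz_pq _ IHy]; first by rewrite scaler0; exact: homog_form0.
by rewrite scalerDr scalerA; apply: homog_formD.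
Qed.

Lemma homog_form_mono n x p q : (size p)%:Z = n + (size q)%:Z ->
  homog_form n (path_mono x p ** ghost_mono x q).
Proof.
move=> sz; rewrite -[_ ** _]addr0 -[_ ** _]scale1r; apply: homog_formD => //.
exact: homog_form0.
Qed.

Lemma homog_form_mull m n a y :
  lpa_deg m a -> homog_form n y -> homog_form (m + n) (a ** y).
Proof.
have gen (m' : int) a' :
    (forall n x p q, (size p)%:Z = n + (size q)%:Z ->
      homog_form (m' + n) (a' ** (path_mono x p ** ghost_mono x q))) ->
    forall n y, homog_form n y -> homog_form (m' + n) (a' ** y).
  move=> mono n' y'; elim=> [|k x p q z sz _ IHz].
    by rewrite nmulr0; exact: homog_form0.
  rewrite nmulDr lpa_scaleAr; apply: homog_form_add => //.
  exact/homog_form_scale/mono.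
move=> am; elim: am n y => {m a} [v|e|e|m|m a b _ IHa _ IHb|m k a _ IHa|m m' a b _ IHa _ IHb] n y ny.
- apply: gen ny => n' x p q sz; rewrite add0r nmulA mul_vertex_path.
  by case: ifP => _; [exact: homog_form_mono | rewrite nmul0r; exact: homog_form0].
- apply: gen ny => n' x p q sz.
  by rewrite nmulA; apply: (@homog_form_mono _ x (e :: p)) => /=; lia.
- apply: gen ny => n' x [|f p] q sz; rewrite nmulA /=.
    rewrite mul_ghost_vertex; case: eqVneq => [->|_]; last by rewrite nmul0r; exact: homog_form0.
    rewrite mul_ghost_ghost_mono eqxx.
    rewrite -[ghost_mono _ _](_ : vx (rng e) ** ghost_mono (rng e) (rcons q e) = _); last first.
      by rewrite mul_vertex_ghost_mono eqxx.
    by apply: (@homog_form_mono _ _ [::]); rewrite size_rcons; move: sz => /=; lia.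
  rewrite nmulA mul_ghost_edge; case: ifP => _; last by rewrite !nmul0r; exact: homog_form0.
  rewrite mul_vertex_path; case: ifP => _; last by rewrite nmul0r; exact: homog_form0.
  by apply: homog_form_mono; move: sz => /=; lia.
- by rewrite nmul0r; exact: homog_form0.
- by rewrite nmulDl; apply: homog_form_add; [exact: IHa | exact: IHb].
- by rewrite lpa_scaleAl; exact/homog_form_scale/IHa.
- by rewrite -nmulA -addrA; exact/IHa/IHb.
Qed.

Lemma lpa_deg_homog_form n y : lpa_deg n y -> homog_form n y.
Proof.
elim=> {n y} [v|e|e|n|n a b _ IHa _ IHb|n k a _ IHa|m n a b am _ _ IHb].
- have := @homog_form_mono 0 v [::] [::] (erefl _).
  by rewrite /= mul_vertex_vertex eqxx.
- have := @homog_form_mono 1 (rng e) [:: e] [::] (erefl _).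
  by rewrite /= !mul_edge_vertex eqxx mul_edge_vertex eqxx.
- have := @homog_form_mono (-1) (rng e) [::] [:: e] (erefl _).
  by rewrite /= !mul_vertex_ghost eqxx mul_vertex_ghost eqxx.
- exact: homog_form0.
- exact: homog_form_add.
- exact: homog_form_scale.
- exact: homog_form_mull IHb.
Qed.

(** Multiplying a homogeneous [y = \sum k p g^*] on the right by a path [q]
    long enough to absorb every [g] leaves a combination of paths of equal
    length, which can be cancelled.  The alternative [g^* z = 0] in the
    hypothesis lets short paths [q] be used too, when they end at a sink or are
    followed by an element [c] killed by the edges that the [g] begin with. *)
Lemma homogeneous_cancel n y : lpa_deg n y ->
  exists B : seq (vertex E * seq (edge E)), forall x q c,
    let z := path_mono x q ** c in
    (forall g, g \in B -> (size g.2 <= size q)%N \/ ghost_mono g.1 g.2 ** z = 0) ->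
    y ** z = 0 \/ exists b, b ** (y ** z) = z.
Proof.
move=> /lpa_deg_homog_form ny.
have [B BP] : exists B : seq (vertex E * seq (edge E)), forall x q c,
    (forall g, g \in B -> (size g.2 <= size q)%N \/
       ghost_mono g.1 g.2 ** (path_mono x q ** c) = 0) ->
    exists s : seq (K * seq (edge E)),
      (forall t, t \in s -> (size t.2)%:Z = n + (size q)%:Z) /\
      y ** (path_mono x q ** c) = (\sum_(t <- s) t.1 *: path_mono x t.2) ** c.
  elim: ny => [|k x' p g y' sz _ [B BP]].
    by exists [::] => x q c _; exists [::]; rewrite big_nil !nmul0r.
  exists ((x', g) :: B) => x q c Bq.
  have [|s [sz_s sE]] := BP x q c; first by move=> h hB; apply: Bq; rewrite inE hB orbT.
  rewrite nmulDl lpa_scaleAl sE -nmulA.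
  have /= [le_gq|->] := Bq (x', g) (mem_head _ _); last first.
    by exists s; rewrite nmulr0 scaler0 add0r.
  rewrite [ghost_mono _ _ ** (_ ** _)]nmulA.
  have [->|->] := mul_ghost_path x' x le_gq.
    by exists s; rewrite nmul0r nmulr0 scaler0 add0r.
  rewrite nmulA mul_path_path; case: ifP => _; last first.
    by exists s; rewrite nmul0r scaler0 add0r.
  exists ((k, p ++ drop (size g) q) :: s); split.
    move=> t; rewrite inE => /orP[/eqP->|/sz_s//] /=.
    by rewrite size_cat size_drop; lia.
  by rewrite big_cons nmulDl lpa_scaleAl.
exists B => x q c z Bq; have [s [sz_s ->]] := BP x q c Bq.
have [//|->|[b bE]] := @path_comb_cancel x (absz (n + (size q)%:Z)) s.
- by move=> t /sz_s <-.
- by left; rewrite nmul0r.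
right; exists (path_mono x q ** b).
by rewrite -nmulA (nmulA b) bE nmulA mul_path_vertex.
Qed.

End LeavittPaths.

(** * Representations; the grading and the vertices *)

Section Representation.
Local Open Scope ring_scope.
Variables (K : fieldType) (E : graph) (W : lmodType K).
Variables (opv : vertex E -> W -> W) (ope opg : edge E -> W -> W).

Record leavitt_family : Prop := LeavittFamily {
  lf_linv : forall v, linear (opv v);
  lf_line : forall e, linear (ope e);
  lf_ling : forall e, linear (opg e);
  lf_vv : forall v h, opv v (opv v h) = opv v h;
  lf_vw : forall v w h, v <> w -> opv v (opv w h) = 0;
  lf_ve : forall e h, opv (src e) (ope e h) = ope e h;
  lf_ev : forall e h, ope e (opv (rng e) h) = ope e h;
  lf_vg : forall e h, opv (rng e) (opg e h) = opg e h;
  lf_gv : forall e h, opg e (opv (src e) h) = opg e h;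
  lf_ge : forall e h, opg e (ope e h) = opv (rng e) h;
  lf_ge0 : forall e f h, e <> f -> opg e (ope f h) = 0;
  lf_reg : forall v h, regular v ->
    opv v h = \sum_(e <- fset_set (emits v)) ope e (opg e h)
}.

Hypothesis lf : leavitt_family.

Fixpoint term_eval (t : term K E) (h : W) : W :=
  match t with
  | tVertex v => opv v h
  | tEdge e => ope e h
  | tGhost e => opg e h
  | tZero => 0
  | tAdd s t => term_eval s h + term_eval t h
  | tScale k t => k *: term_eval t h
  | tMul s t => term_eval s (term_eval t h)
  end.

Lemma term_eval_linear t : linear (term_eval t).
Proof.
case: lf => linv line ling _ _ _ _ _ _ _ _ _.
elim: t => [v|e|e||s IHs t IHt|k t IHt|s IHs t IHt] c g h /=.
- exact: linv.
- exact: line.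
- exact: ling.
- by rewrite scaler0 addr0.
- by rewrite IHs IHt scalerDr addrACA.
- by rewrite IHt scalerDr !scalerA mulrC.
- by rewrite IHt IHs.
Qed.

Lemma term_eval_rel s t : lpa_rel s t -> forall h, term_eval s h = term_eval t h.
Proof.
have lin0 u : term_eval u 0 = 0.
  by have := term_eval_linear u (-1) 0 0; rewrite !scaleN1r addr0 oppr0 addNr.
elim=> {s t} //=.
- by move=> x y z _ xy _ yz h; rewrite xy yz.
- by move=> x x' y y' _ xE _ yE h; rewrite xE yE.
- by move=> k x x' _ xE h; rewrite xE.
- by move=> x x' y y' _ xE _ yE h; rewrite yE xE.
- by move=> x y z h; rewrite addrA.
- by move=> x y h; rewrite addrC.
- by move=> x h; rewrite add0r.
- by move=> x h; rewrite scale0r.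
- by move=> x h; rewrite scale1r.
- by move=> k l x h; rewrite scalerA.
- by move=> k l x h; rewrite scalerDl.
- by move=> k x y h; rewrite scalerDr.
- by move=> x y z h; have := term_eval_linear x 1 (term_eval y h) (term_eval z h); rewrite !scale1r.
- move=> k x y h; have := term_eval_linear x k (term_eval y h) 0.
  by rewrite !addr0 lin0 addr0.
- exact: (lf_vv lf).
- by move=> v w vw h; exact: (lf_vw lf).
- exact: (lf_ve lf).
- exact: (lf_ev lf).
- exact: (lf_vg lf).
- exact: (lf_gv lf).
- exact: (lf_ge lf).
- by move=> e f ef h; exact: (lf_ge0 lf).
- move=> v vreg h; rewrite (lf_reg lf) //.
  by rewrite (big_morph (fun t => term_eval t h) (id1 := 0) (op1 := +%R)).
Qed.

Definition lpa_eval (a : lpa K E) : W -> W := term_eval (lpa_repr a).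

Lemma lpa_eval_pi t h : lpa_eval (lpa_pi t) h = term_eval t h.
Proof. exact/term_eval_rel/rel_repr_pi. Qed.

Lemma lpa_evalD a b h : lpa_eval (a + b) h = lpa_eval a h + lpa_eval b h.
Proof. exact: lpa_eval_pi. Qed.

Lemma lpa_eval0 h : lpa_eval 0 h = 0.
Proof. exact: lpa_eval_pi. Qed.

Lemma lpa_evalZ k a h : lpa_eval (k *: a) h = k *: lpa_eval a h.
Proof. exact: lpa_eval_pi. Qed.

Lemma lpa_evalM a b h : lpa_eval (a ** b) h = lpa_eval a (lpa_eval b h).
Proof. exact: lpa_eval_pi. Qed.

Lemma lpa_eval_sum (I : Type) (s : seq I) (F : I -> lpa K E) h :
  lpa_eval (\sum_(i <- s) F i) h = \sum_(i <- s) lpa_eval (F i) h.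
Proof.
apply: (big_morph (fun a => lpa_eval a h)) => [a b|]; first exact: lpa_evalD.
exact: lpa_eval0.
Qed.

End Representation.

Section GradingIndependence.
Local Open Scope ring_scope.
Variables (K : fieldType) (E : graph).
Local Notation L := (lpa K E).

(** Left multiplication on the unitization [L * K], where [(0, 1)] is the
    adjoined identity. *)
Definition unitized_mul (a : L) (h : L * K^o) : L * K^o := (a ** h.1 + (h.2 : K) *: a, 0).

Lemma unitized_mulA a b h : unitized_mul a (unitized_mul b h) = unitized_mul (a ** b) h.
Proof. by rewrite /unitized_mul /= scale0r addr0 nmulDr nmulA lpa_scaleAr. Qed.

Lemma unitized_mul_linear a : linear (unitized_mul a).
Proof.
move=> k g h; rewrite /unitized_mul; congr (_, _) => /=.
  rewrite nmulDr lpa_scaleAr scalerDl scalerDr addrACA.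
  by rewrite -[k *: g.2]/(k * g.2) -scalerA.
by rewrite scaler0 addr0.
Qed.

Lemma unitized_mul0 h : unitized_mul 0 h = 0.
Proof. by rewrite /unitized_mul nmul0r scaler0 addr0. Qed.

Lemma unitized_mulD a b h :
  unitized_mul (a + b) h = unitized_mul a h + unitized_mul b h.
Proof.
rewrite /unitized_mul; congr (_, _) => /=; last by rewrite addr0.
by rewrite nmulDl scalerDr addrACA.
Qed.

Lemma unitized_mulZ k a h : unitized_mul (k *: a) h = k *: unitized_mul a h.
Proof.
rewrite /unitized_mul; congr (_, _) => /=; last by rewrite scaler0.
by rewrite lpa_scaleAl scalerDr !scalerA mulrC.
Qed.

Local Notation W := (int -> L * K^o).
Definition shift_mul (n : int) (a : L) (h : W) : W := fun k => unitized_mul a (h (k - n)).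

Lemma shift_mulA m n a b h :
  shift_mul m a (shift_mul n b h) = shift_mul (m + n) (a ** b) h.
Proof.
apply/funext => k; rewrite /shift_mul unitized_mulA; congr (unitized_mul _ (h _)).
by lia.
Qed.

Lemma shift_family : leavitt_family (W := W)
  (fun v => shift_mul 0 (lpa_vertex K v)) (fun e => shift_mul 1 (lpa_edge K e))
  (fun e => shift_mul (-1) (lpa_ghost K e)).
Proof.
have lin n a : linear (shift_mul n a).
  by move=> k g h; apply/funext => i; exact: unitized_mul_linear.
have mul0 n h : shift_mul n 0 h = 0.
  by apply/funext => k; exact: unitized_mul0.
split=> //=.
- by move=> v h; rewrite shift_mulA mul_vertex_vertex eqxx.
- by move=> v w h /eqP vw; rewrite shift_mulA mul_vertex_vertex (negbTE vw) mul0.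
- by move=> e h; rewrite shift_mulA mul_vertex_edge eqxx.
- by move=> e h; rewrite shift_mulA mul_edge_vertex eqxx.
- by move=> e h; rewrite shift_mulA mul_vertex_ghost eqxx.
- by move=> e h; rewrite shift_mulA mul_ghost_vertex eqxx.
- by move=> e h; rewrite shift_mulA mul_ghost_edge eqxx.
- by move=> e f h /eqP ef; rewrite shift_mulA mul_ghost_edge (negbTE ef) mul0.
move=> v h vreg; under eq_bigr do rewrite shift_mulA.
rewrite (regular_vertexE _ vreg) subrr.
apply: (big_morph (fun a => shift_mul 0 a h)) => [a b|]; last exact: mul0.
by apply/funext => k; exact: unitized_mulD.
Qed.

Lemma shift_eval n a h : lpa_deg n a ->
  lpa_eval (fun v => shift_mul 0 (lpa_vertex K v)) (fun e => shift_mul 1 (lpa_edge K e))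
    (fun e => shift_mul (-1) (lpa_ghost K e)) a h = shift_mul n a h.
Proof.
have lf := shift_family.
move=> na; elim: na h => {n a} [v|e|e|n|n a b _ IHa _ IHb|n k a _ IHa|m n a b _ IHa _ IHb] h.
- exact: (lpa_eval_pi lf).
- exact: (lpa_eval_pi lf).
- exact: (lpa_eval_pi lf).
- by rewrite (lpa_eval0 lf); apply/funext => k; rewrite /shift_mul unitized_mul0.
- rewrite (lpa_evalD lf) IHa IHb; apply/funext => k.
  by rewrite /shift_mul unitized_mulD.
- rewrite (lpa_evalZ lf) IHa; apply/funext => i.
  by rewrite /shift_mul unitized_mulZ.
- by rewrite (lpa_evalM lf) IHb IHa shift_mulA.
Qed.

(** Letting a degree [n] element shift functions on the integers by [n] while
    acting on their values separates the degrees: applied to the function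
    concentrated at [0] with value [1], the sum becomes the list of its terms. *)
Lemma lpa_deg_independent (s : seq int) (a : int -> L) : uniq s ->
    (forall n, n \in s -> lpa_deg n (a n)) ->
  \sum_(n <- s) a n = 0 -> forall n, n \in s -> a n = 0.
Proof.
move=> s_uniq a_deg sum0 n ns; have lf := shift_family.
pose one0 : W := fun k => if k == 0 then (0, 1) else 0.
have : lpa_eval (fun v => shift_mul 0 (lpa_vertex K v))
    (fun e => shift_mul 1 (lpa_edge K e)) (fun e => shift_mul (-1) (lpa_ghost K e))
    (\sum_(i <- s) a i) one0 n = 0.
  by rewrite sum0 (lpa_eval0 lf).
rewrite (lpa_eval_sum lf) big_seq.
under eq_bigr => i i_s do rewrite (shift_eval _ (a_deg i i_s)).
rewrite -big_seq (bigD1_seq n) //=.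
rewrite addrfctE fct_sumE big1 ?addr0 => [|i ni].
  rewrite /shift_mul /one0 subrr eqxx /unitized_mul /= nmulr0 add0r scale1r.
  by case.
rewrite /shift_mul /one0 subr_eq0 eq_sym (negbTE ni) /unitized_mul /=.
by rewrite nmulr0 scale0r addr0.
Qed.

End GradingIndependence.

Section VertexNonzero.
Local Open Scope ring_scope.
Variables (K : fieldType) (E : graph).
Implicit Types (v w : vertex E) (e f : edge E).

(** Every vertex gets the same fibre [Y = seq (edge E) * nat], large enough
    that [Y] is the disjoint union of the images of injections [fibre_enc e],
    for [e] leaving a regular vertex, and contains disjoint images for all the
    edges leaving an infinite emitter.  In the first case the [i]-th of [m]
    edges sends [k] to [m * k + i]; in the second an edge is recorded by
    prepending it to the list. *)
Local Notation Y := (seq (edge E) * nat)%type.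

Definition out_edges v : seq (edge E) := fset_set (emits v).

Definition fibre_enc e (y : Y) : Y :=
  if `[< regular (src e) >] then
    (y.1, y.2 * size (out_edges (src e)) + index e (out_edges (src e)))%N
  else (e :: y.1, y.2).

Definition fibre_dec e (y : Y) : option Y :=
  if `[< regular (src e) >] then
    if (y.2 %% size (out_edges (src e)) == index e (out_edges (src e)))%N
    then Some (y.1, y.2 %/ size (out_edges (src e)))%N else None
  else if y.1 is f :: s then if f == e then Some (s, y.2) else None else None.

Lemma mem_out_edges e : regular (src e) -> e \in out_edges (src e).
Proof. by case=> _ fin; rewrite in_fset_set // inE. Qed.

Lemma fibre_encK e : pcancel (fibre_enc e) (fibre_dec e).
Proof.
move=> [s k]; rewrite /fibre_dec /fibre_enc; case: asboolP => [reg|_] /=; last by rewrite eqxx.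
have lt_i : (index e (out_edges (src e)) < size (out_edges (src e)))%N.
  by rewrite index_mem mem_out_edges.
rewrite modnMDl modn_small // eqxx divnMDl ?(leq_ltn_trans _ lt_i) //.
by rewrite divn_small // addn0.
Qed.

Lemma fibre_dec_enc e f y : e <> f -> src e = src f ->
  fibre_dec e (fibre_enc f y) = None.
Proof.
move=> ef src_ef; rewrite /fibre_dec /fibre_enc src_ef.
case: asboolP => [reg|_] /=; last by case: eqP => // fe; case: ef.
have fs := mem_out_edges reg.
have es : e \in out_edges (src f) by rewrite -src_ef mem_out_edges ?src_ef.
rewrite modnMDl modn_small ?index_mem //; case: eqP => // idx; case: ef.
by have := congr1 (nth e (out_edges (src f))) idx; rewrite !nth_index.
Qed.

Lemma fibre_cover v y : regular v ->
  exists e y', [/\ src e = v, fibre_dec e y = Some y' & fibre_enc e y' = y].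
Proof.
case: y => [s k] reg; have [[e0 e0v] fin] := reg.
set m := size (out_edges v).
have m_gt0 : (0 < m)%N.
  have /= src_e0 : src e0 = v by [].
  by have := @mem_out_edges e0; rewrite src_e0 /m => /(_ reg); case: (out_edges v).
have km : (k %% m < m)%N by rewrite ltn_mod.
set e := nth e0 (out_edges v) (k %% m).
have ev : src e = v by have := mem_nth e0 km; rewrite in_fset_set // inE.
have ie : index e (out_edges v) = (k %% m)%N by rewrite index_uniq // fset_uniq.
exists e, (s, (k %/ m)%N); split => //.
  by rewrite /fibre_dec ev; case: asboolP => // _; rewrite ie -/m /= eqxx.
by rewrite /fibre_enc ev; case: asboolP => // _ /=; rewrite ie -/m -divn_eq.
Qed.

Local Notation W := (vertex E * Y -> K^o).

Definition fibre_vertex v (h : W) : W := fun x => if x.1 == v then h x else 0.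

Definition fibre_edge e (h : W) : W := fun x =>
  if x.1 == src e then
    if fibre_dec e x.2 is Some y then h (rng e, y) else 0
  else 0.

Definition fibre_ghost e (h : W) : W := fun x =>
  if x.1 == rng e then h (src e, fibre_enc e x.2) else 0.

(** The operators act on functions on [vertex E * Y] by moving along the
    injections; at a regular vertex the images of the injections cover the
    fibre, which is the last relation. *)
Lemma fibre_family : leavitt_family fibre_vertex fibre_edge fibre_ghost.
Proof.
split.
- move=> v k g h; apply/funext => -[w y]; rewrite /fibre_vertex !fctE /=.
  by case: ifP => //; rewrite scaler0 addr0.
- move=> e k g h; apply/funext => -[w y]; rewrite /fibre_edge !fctE /=.
  by case: ifP => _; [case: (fibre_dec e y) => [z|] //|]; rewrite scaler0 addr0.
- move=> e k g h; apply/funext => -[w y]; rewrite /fibre_ghost !fctE /=.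
  by case: ifP => //; rewrite scaler0 addr0.
- by move=> v h; apply/funext => -[w y]; rewrite /fibre_vertex /=; case: eqP.
- move=> v v' h vv'; apply/funext => -[w y]; rewrite /fibre_vertex /=.
  by case: eqP => // ->; case: eqP.
- by move=> e h; apply/funext => -[w y]; rewrite /fibre_vertex /fibre_edge /=; case: eqP.
- move=> e h; apply/funext => -[w y]; rewrite /fibre_vertex /fibre_edge /=.
  by rewrite eqxx.
- by move=> e h; apply/funext => -[w y]; rewrite /fibre_vertex /fibre_ghost /=; case: eqP.
- move=> e h; apply/funext => -[w y]; rewrite /fibre_vertex /fibre_ghost /=.
  by rewrite eqxx.
- move=> e h; apply/funext => -[w y]; rewrite /fibre_vertex /fibre_ghost /fibre_edge /=.
  by case: eqP => // ->; rewrite eqxx fibre_encK.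
- move=> e f h ef; apply/funext => -[w y]; rewrite /fibre_ghost /fibre_edge /=.
  by case: ifP => // _; case: eqP => // src_ef; rewrite fibre_dec_enc //; exact: nesym.
move=> v h reg; apply/funext => -[w y]; rewrite fct_sumE.
have [_ fin] := reg.
have [wv|wv] := eqVneq w v; last first.
  rewrite /fibre_vertex /= (negbTE wv) big_seq big1 // => e.
  by rewrite in_fset_set // inE /= => ev; rewrite /fibre_edge /= ev (negbTE wv).
have [e [y' [ev ey ye]]] := fibre_cover y reg.
rewrite wv (bigD1_seq e) ?fset_uniq //=; last by rewrite in_fset_set // inE.
rewrite big_seq_cond big1 ?addr0 => [|f /andP[]].
  by rewrite /fibre_vertex /fibre_edge /fibre_ghost /= ev !eqxx ey /= ?eqxx ye.
rewrite in_fset_set // inE /= => fv /eqP fe.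
by rewrite /fibre_edge /= -ye fibre_dec_enc ?ev //; case: ifP.
Qed.

Lemma lpa_vertex_neq0 v : lpa_vertex K v <> 0.
Proof.
move=> v0; have lf := fibre_family.
pose h : W := fun => 1.
have : lpa_eval fibre_vertex fibre_edge fibre_ghost (lpa_vertex K v) h (v, ([::], 0%N)) = 0.
  by rewrite v0 (lpa_eval0 lf).
rewrite (lpa_eval_pi lf) /= /fibre_vertex eqxx => /eqP.
by rewrite (oner_eq0 K).
Qed.

Lemma lpa_ghost_neq0 e : lpa_ghost K e <> 0.
Proof.
move=> e0; apply: (@lpa_vertex_neq0 (rng e)).
by have := mul_ghost_edge K e e; rewrite eqxx e0 nmul0r.
Qed.

End VertexNonzero.

(** * Vertices with no bifurcation below them *)

Section Graphs.
Variable E : graph.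
Implicit Types (u v w x : vertex E) (e f : edge E) (p q c : seq (edge E)).

Definition unbranched v : Prop := forall w, reachable v w -> ~ bifurcation w.

Definition eventually_unbranched (n : nat) u : Prop := forall p,
  is_path u p -> (n <= size p)%N -> unbranched (path_end u p).

Lemma is_path_cons u e q : is_path u (e :: q) = (src e == u) && is_path (rng e) q.
Proof. by case: q => [|f q] //=; rewrite [src f == _]eq_sym. Qed.

Lemma is_path_cat u p q : is_path u (p ++ q) = is_path u p && is_path (path_end u p) q.
Proof.
elim: p u => [|e p IHp] u //.
by rewrite cat_cons !is_path_cons IHp -andbA.
Qed.

Lemma path_end_cat u p q : path_end u (p ++ q) = path_end (path_end u p) q.
Proof. by rewrite /path_end map_cat last_cat. Qed.

Lemma reachable_refl v : reachable v v.
Proof. by exists [::]. Qed.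

Lemma reachable_edge e w : reachable (rng e) w -> reachable (src e) w.
Proof.
by move=> [p [pP pE]]; exists (e :: p); rewrite is_path_cons eqxx pP.
Qed.

Lemma reachable_trans u v w : reachable u v -> reachable v w -> reachable u w.
Proof.
move=> [p [pP pE]] [q [qP qE]]; exists (p ++ q).
by rewrite is_path_cat pP pE qP path_end_cat pE.
Qed.

Lemma unbranched_reachable v w : unbranched v -> reachable v w -> unbranched w.
Proof. by move=> nv vw x wx; exact/nv/(reachable_trans vw). Qed.

Lemma mem_path_vertices0 u x : (x \in path_vertices u [::]) = (x == u).
Proof. by rewrite inE. Qed.

Lemma mem_path_vertices_cons u e p x :
  (x \in path_vertices u (e :: p)) = (x == u) || (x \in path_vertices (rng e) p).
Proof. by rewrite inE. Qed.

Lemma mem_path_vertices_cat u p q x :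
  (x \in path_vertices u (p ++ q)) = (x \in path_vertices u p) || (x \in map rng q).
Proof. by rewrite /path_vertices map_cat -cat_cons mem_cat. Qed.

Lemma path_vertices_reachable u p x :
  is_path u p -> x \in path_vertices u p -> reachable u x.
Proof.
elim: p u => [|e p IHp] u.
  by rewrite mem_path_vertices0 => _ /eqP ->; exact: reachable_refl.
rewrite is_path_cons => /andP[/eqP <- eP].
rewrite mem_path_vertices_cons => /orP[/eqP ->|]; first exact: reachable_refl.
by move/(IHp _ eP); exact: reachable_edge.
Qed.

Lemma mem_path_vertices_src u p e :
  is_path u p -> e \in p -> src e \in path_vertices u p.
Proof.
elim: p u => [|f p IHp] u //.
rewrite is_path_cons inE mem_path_vertices_cons => /andP[/eqP fu fP] /orP[/eqP ->|ep].
  by rewrite fu eqxx.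
by rewrite IHp ?orbT.
Qed.

Lemma path_vertices_src u p x : is_path u p -> x \in path_vertices u p ->
  x = path_end u p \/ exists2 e, e \in p & src e = x.
Proof.
elim: p u => [|e p IHp] u; first by rewrite mem_path_vertices0 => _ /eqP; left.
rewrite is_path_cons mem_path_vertices_cons => /andP[/eqP eu eP] /orP[/eqP ->|].
  by right; exists e; rewrite ?mem_head.
move/(IHp _ eP) => [->|[f fp fx]]; first by left.
by right; exists f => //; rewrite inE fp orbT.
Qed.

Lemma cycle_is_path c v : is_cycle c -> based_at c v ->
  is_path v c /\ path_end v c = v.
Proof.
move=> /and3P[_ + _] [e [q [cE <-]]]; rewrite {c}cE.
rewrite /cycle rcons_path /= eqxx => /andP[-> /eqP eE]; split=> //.
by rewrite /path_end /= last_map.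
Qed.

Lemma cycle_vertex_src c v x : is_cycle c -> based_at c v ->
  x \in path_vertices v c -> exists2 e, e \in c & src e = x.
Proof.
move=> cc cv xc; have [cP cE] := cycle_is_path cc cv.
have [->|//] := path_vertices_src cP xc.
by rewrite cE; case: cv => e [q [-> ev]]; exists e; rewrite ?mem_head.
Qed.

(** Below an unbranched vertex there is a single path; either it never meets
    a cycle, or it runs into one, which then has no exit and absorbs it. *)
Lemma unbranchedP v : unbranched v <-> line_point v \/ laurent_vertex v.
Proof.
split=> [nv|[line|[mu [c [[muP mu_nobif] cc noexit cv vE]]]]]; last 2 first.
- by move=> w /line[].
- move=> w; rewrite vE => wV; have {wV} : w \in path_vertices v (mu ++ c) by [].
  rewrite mem_path_vertices_cat => /orP[/mu_nobif//|wc].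
  have wc' : w \in path_vertices (path_end v mu) c by rewrite inE wc orbT.
  have [e ec ew] := cycle_vertex_src cc cv wc'.
  move=> [f [g [fw gw fg]]]; case: (eqVneq f e) => [fe|/eqP fe].
    by apply: (noexit g); exists e; split; rewrite ?gw ?ew // -fe; exact: nesym.
  by apply: (noexit f); exists e; split; rewrite ?fw ?ew.
case: (pselect (line_point v)) => [|notline]; [by left | right].
have [w [c [[mu [muP muE]] cc cw]]] : exists w c,
    [/\ reachable v w, is_cycle c & based_at c w].
  apply: contrapT => none; apply: notline => w vw; split; first exact: nv.
  by move=> [c [cc cw]]; apply: none; exists w, c.
rewrite -muE in cw.
have [cP cE] := cycle_is_path cc cw.
have pP : is_path v (mu ++ c) by rewrite is_path_cat muP.
exists mu, c; split => //.
- by split=> // x xmu; apply: nv; exact: path_vertices_reachable xmu.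
- move=> f [e [ec fe nfe]]; apply: (nv (src e)); last by exists f, e.
  apply: (path_vertices_reachable pP); apply: (mem_path_vertices_src pP).
  by rewrite mem_cat ec orbT.
have closed q y : reachable v y -> y \in path_vertices v (mu ++ c) ->
    is_path y q -> path_end y q \in path_vertices v (mu ++ c).
  elim: q y => [|e q IHq] y vy yV //.
  rewrite is_path_cons => /andP[/eqP ey qP].
  have [e' e'p e'y] : exists2 e', e' \in mu ++ c & src e' = y.
    have [->|//] := path_vertices_src pP yV.
    rewrite path_end_cat cE; case: (cw) => e' [q' [c_eq <-]]; exists e' => //.
    by rewrite c_eq mem_cat mem_head orbT.
  have ee' : e = e' by apply: contrapT => ee'; apply: (nv y) => //; exists e, e'.
  apply: (IHq (rng e)) => //; last by rewrite inE ee' (map_f rng e'p) orbT.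
  by apply: reachable_trans vy _; rewrite -ey; exact/reachable_edge/reachable_refl.
apply/seteqP; split=> [x [q [qP <-]]|x xV]; last exact: path_vertices_reachable xV.
by apply: closed qP; [exact: reachable_refl | rewrite mem_head].
Qed.

Lemma eventually_unbranched_step u : row_finite E ->
    (forall e, src e = u -> exists n, eventually_unbranched n (rng e)) ->
  exists n, eventually_unbranched n u.
Proof.
move=> rf next.
have /choice[n nP] e : exists n, src e = u -> eventually_unbranched n (rng e).
  case: (pselect (src e = u)) => [/next[n en]|neq]; first by exists n.
  by exists 0%N.
exists (\max_(e <- fset_set (emits u)) n e).+1 => -[|e q] //.
rewrite is_path_cons => /andP[/eqP eu qP]; rewrite /= ltnS => sz.
apply: (nP e) => //.
apply: leq_trans sz; rewrite (big_rem e) ?leq_maxl //=.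
by rewrite in_fset_set // inE.
Qed.

(** König's lemma: a vertex below which branching never stops starts an
    infinite path along which branching never stops, which must then cross
    infinitely many bifurcations itself. *)
Lemma infinite_branching_path u : row_finite E ->
    (forall n, ~ eventually_unbranched n u) ->
  exists e : nat -> edge E, [/\ src (e 0) = u, forall n, rng (e n) = src (e n.+1)
    & forall n, exists2 m, (n <= m)%N & bifurcation (src (e m))].
Proof.
move=> rf notu; pose H v := ~ exists n, eventually_unbranched n v.
have Hnext v : H v -> exists e, src e = v /\ H (rng e).
  move=> Hv; apply: contrapT => none; apply: Hv.
  apply: eventually_unbranched_step => // e ev.
  by apply: contrapT => He; apply: none; exists e.
have Hu : H u by move=> [n /notu].
have [e0 _] := Hnext u Hu.
have /choice[next nextP] v : exists e, H v -> src e = v /\ H (rng e).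
  case: (pselect (H v)) => [/Hnext[e eP]|nH]; first by exists e.
  by exists e0.
pose vs n := iter n (fun v => rng (next v)) u.
have HV n : H (vs n).
  by elim: n => [//|n IHn]; rewrite /vs iterS -/(vs n); case: (nextP _ IHn).
have srcE n : src (next (vs n)) = vs n by case: (nextP _ (HV n)).
exists (fun n => next (vs n)); split => [|n|n]; first exact: (srcE 0).
  by rewrite srcE.
apply: contrapT => none; apply: (HV n); exists 0%N => p pP _.
have nobif m : (n <= m)%N -> ~ bifurcation (vs m).
  by move=> le_nm bif; apply: none; exists m; rewrite ?srcE.
have on_path q m : (n <= m)%N -> is_path (vs m) q ->
    exists2 k, (n <= k)%N & path_end (vs m) q = vs k.
  elim: q m => [|e q IHq] m le_nm; first by exists m.
  rewrite is_path_cons => /andP[/eqP em qP].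
  have ee : e = next (vs m).
    apply: contrapT => neq; apply: (nobif m) => //.
    by exists e, (next (vs m)).
  by rewrite ee in qP *; exact: (IHq m.+1 (leqW le_nm)).
have [k le_nk ->] := on_path p n (leqnn n) pP => w [q [qP <-]].
by have [l le_nl ->] := on_path q k le_nk qP; exact: nobif.
Qed.

End Graphs.

(** * Direct sums and homogeneous components *)

Section FamilySums.
Local Open Scope ring_scope.
Variables (V : zmodType) (I : choiceType) (S : I -> set V).
Hypothesis S_subgroup : forall i, is_subgroup (S i).

Definition family_sum (x : V) : Prop := exists (s : seq I) (f : I -> V),
  [/\ uniq s, forall i, S i (f i) & x = \sum_(i <- s) f i].

Let S0 i : S i 0. Proof. by case: (S_subgroup i). Qed.

Let SD i x y : S i x -> S i y -> S i (x + y).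
Proof.
move=> Sx Sy; have [_ SB] := S_subgroup i.
by rewrite -[y]opprK -(sub0r y); apply: (SB) => //; exact: SB.
Qed.

Lemma family_sum0 : family_sum 0.
Proof. by exists [::], (fun=> 0); rewrite big_nil. Qed.

Lemma family_sum_mem i x : S i x -> family_sum x.
Proof.
move=> Sx; exists [:: i], (fun j => if j == i then x else 0); split => //.
  by move=> j; case: eqP => [->|].
by rewrite big_seq1 eqxx.
Qed.

Lemma family_sumD x y : family_sum x -> family_sum y -> family_sum (x + y).
Proof.
move=> [s [f [s_uniq Sf ->]]] [t [g [t_uniq Sg ->]]].
exists (undup (s ++ t)),
  (fun i => (if i \in s then f i else 0) + (if i \in t then g i else 0)).
split=> [||]; first exact: undup_uniq.
  by move=> i; apply: SD; case: ifP.
have restrict (r : seq I) (h : I -> V) : uniq r -> {subset r <= s ++ t} ->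
    \sum_(i <- undup (s ++ t)) (if i \in r then h i else 0) = \sum_(i <- r) h i.
  move=> r_uniq sub; rewrite -big_mkcond -big_filter; apply: perm_big.
  apply: uniq_perm => //; first by rewrite filter_uniq ?undup_uniq.
  move=> i; rewrite mem_filter mem_undup; case ir: (i \in r) => //=.
  exact: sub.
by rewrite big_split /= !restrict // => i; rewrite mem_cat => ->; rewrite ?orbT.
Qed.

Lemma family_sum_sum (J : Type) (r : seq J) (F : J -> V) :
  (forall j, family_sum (F j)) -> family_sum (\sum_(j <- r) F j).
Proof.
by move=> FP; apply: big_ind => //; [exact: family_sum0 | exact: family_sumD].
Qed.

End FamilySums.

Section GradedModules.
Local Open Scope ring_scope.
Local Open Scope classical_set_scope.
Variables (R : nonUnitalRingType) (R_ : int -> set R).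
Variables (M : fullModType R) (M_ : int -> set M).

Lemma graded_submodule_homogeneous (N : set M) : graded_submodule M_ N ->
  N <> [set 0] -> exists n y, [/\ M_ n y, N y & y <> 0].
Proof.
move=> [subN grN] N0; apply: contrapT => none; apply: N0.
apply/seteqP; split=> [x Nx|x ->]; last by case: subN => -[].
have [s [f [_ fP ->]]] := grN x Nx.
rewrite /= big1 // => n _; apply: contrapT => fn0.
by apply: none; exists n, (f n); case: (fP n).
Qed.

End GradedModules.

Section HomogeneousSums.
Local Open Scope ring_scope.
Variables (K : fieldType) (E : graph).
Local Notation L := (lpa K E).

Lemma lpa_pi_add (s t : term K E) : lpa_pi (tAdd s t) = lpa_pi s + lpa_pi t.
Proof. by rewrite -lpa_piD. Qed.

Lemma lpa_pi_scale k (t : term K E) : lpa_pi (tScale k t) = k *: lpa_pi t.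
Proof. by rewrite -lpa_piZ. Qed.

Lemma lpa_pi_mul (s t : term K E) : lpa_pi (tMul s t) = lpa_pi s ** lpa_pi t.
Proof. by rewrite -lpa_piM. Qed.

Lemma lpa_degN n (a : L) : lpa_deg n a -> lpa_deg n (- a).
Proof. by rewrite -scaleN1r; exact: deg_scale. Qed.

Lemma lpa_deg_subgroup n : is_subgroup (lpa_deg n : set L).
Proof.
split=> [|a b na nb]; first exact: deg_zero.
by apply: deg_add => //; exact: lpa_degN.
Qed.

(** A left ideal containing the vertices is everything, since every generator
    is a left multiple of a vertex. *)
Lemma lpa_left_ideal_full (P : set L) :
    (forall a b, P a -> P b -> P (a + b)) -> P 0 ->
    (forall a b, P b -> P (a ** b)) -> (forall v, P (lpa_vertex K v)) ->
  forall a, P a.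
Proof.
move=> PD P0 PM Pv a; rewrite -[a]lpa_reprK.
rewrite -[lpa_pi _]scale1r.
elim: (lpa_repr a) 1 => {a} [v|e|e||s IHs t IHt|l t IHt|s _ t IHt] k.
- have := PM (k *: lpa_vertex K v) _ (Pv v).
  by rewrite lpa_scaleAl mul_vertex_vertex eqxx.
- have := PM (k *: lpa_edge K e) _ (Pv (rng e)).
  by rewrite lpa_scaleAl mul_edge_vertex eqxx.
- have := PM (k *: lpa_ghost K e) _ (Pv (src e)).
  by rewrite lpa_scaleAl mul_ghost_vertex eqxx.
- by rewrite scaler0.
- by rewrite lpa_pi_add scalerDr; apply: PD.
- by rewrite lpa_pi_scale scalerA.
- by rewrite lpa_pi_mul -lpa_scaleAl; apply: PM; rewrite -[lpa_pi t]scale1r.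
Qed.

Lemma lpa_homogeneous_sum (a : L) : family_sum (fun n => lpa_deg n : set L) a.
Proof.
have subg n := lpa_deg_subgroup n.
rewrite -[a]lpa_reprK; elim: (lpa_repr a) => {a} [v|e|e||s IHs t IHt|k t IHt|s IHs t IHt].
- by apply: (family_sum_mem subg (i := 0)); exact: deg_vertex.
- by apply: (family_sum_mem subg (i := 1)); exact: deg_edge.
- by apply: (family_sum_mem subg (i := -1)); exact: deg_ghost.
- exact: family_sum0.
- by rewrite lpa_pi_add; exact: family_sumD.
- rewrite lpa_pi_scale; have [r [f [r_uniq fP ->]]] := IHt.
  exists r, (fun n => k *: f n); split => //; last exact: scaler_sumr.
  by move=> n; exact/deg_scale/fP.
rewrite lpa_pi_mul; have [r [f [_ fP ->]]] := IHs; have [r' [g [_ gP ->]]] := IHt.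
rewrite nmul_suml; apply: family_sum_sum => // m; rewrite nmul_sumr.
apply: family_sum_sum => // n.
by apply: (family_sum_mem subg (i := m + n)); exact: deg_mul.
Qed.

End HomogeneousSums.

(** * Primitive idempotents: from the graph condition to semisimplicity *)

Section Primitive.
Local Open Scope ring_scope.
Local Open Scope classical_set_scope.
Variables (K : fieldType) (E : graph).
Local Notation L := (lpa K E).
Local Notation vx := (@lpa_vertex K E).
Local Notation ed := (@lpa_edge K E).
Local Notation gh := (@lpa_ghost K E).
Implicit Types (a b f g y z : L) (u v w x : vertex E) (e : edge E).

(** Conditions on a degree [0] idempotent [f] which make [L f] a minimal graded
    left ideal: each nonzero homogeneous [y f] generates it again.  Unlike
    minimality, they pass from [f] to [e f e^*] by a short computation. *)
Record graded_primitive f : Prop := GradedPrimitive {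
  primitive_deg : lpa_deg 0 f;
  primitive_idem : f ** f = f;
  primitive_neq0 : f <> 0;
  primitive_cancel : forall n y, lpa_deg n y -> y ** f <> 0 ->
    exists b, b ** (y ** f) = f
}.

Lemma graded_primitive_minimal f : graded_primitive f ->
  minimal_graded_left_ideal [set a | a ** f = a].
Proof.
move=> [f_deg f_idem f_neq0 f_cancel]; split.
- split; first split.
  + by split=> /= [|a b af bf]; rewrite ?nmul0r // nmulBl af bf.
  + by move=> a b /= bf; rewrite -[RHS]/(a ** b) -[in RHS]bf nmulA.
  move=> a /= af; have [s [h [s_uniq hP aE]]] := lpa_homogeneous_sum a.
  exists s, (fun n => h n ** f); split => //.
    move=> n; split; last by rewrite /= -nmulA f_idem.
    by have := deg_mul (hP n) f_deg; rewrite addr0.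
  by rewrite -{1}af {1}aE nmul_suml.
- by move=> /seteqP[/(_ f f_idem)/f_neq0].
move=> J grJ subJ; case: (pselect (J = [set 0])) => [|/(graded_submodule_homogeneous grJ)]; first by left.
move=> [n [y [y_deg Jy y_neq0]]]; right; apply/seteqP; split=> // a /= af.
have yf : y ** f = y := subJ y Jy.
have [|b bE] := f_cancel n y y_deg; first by rewrite yf.
have [[_ subm] _] := grJ.
by rewrite -af; apply: (subm a); rewrite -bE yf; exact: (subm b).
Qed.

(** Right multiplication by [e^*] identifies [L f] with [L e f e^*]. *)
Lemma graded_primitive_transport f e : graded_primitive f -> f ** vx (rng e) = f ->
  vx (rng e) ** f = f -> graded_primitive (ed e ** f ** gh e).
Proof.
move=> [f_deg f_idem f_neq0 f_cancel] fv vf.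
have back : gh e ** (ed e ** f ** gh e) = f ** gh e.
  by rewrite !nmulA mul_ghost_edge eqxx vf.
have cancelr a : a ** gh e = 0 -> a ** vx (rng e) = 0.
  by move=> ae; have := mul_ghost_edge K e e; rewrite eqxx => <-; rewrite nmulA ae nmul0r.
split.
- exact: (deg_mul (deg_mul (deg_edge K e) f_deg) (deg_ghost K e)).
- by rewrite -[LHS]nmulA back nmulA -(nmulA (ed e)) f_idem.
- move=> fe0; apply: f_neq0; rewrite -fv; apply: cancelr.
  by rewrite -back fe0 nmulr0.
move=> n y y_deg yf; have [||b bE] := f_cancel (n + 1) (y ** ed e).
- by apply: deg_mul => //; exact: deg_edge.
- by move=> yf0; apply: yf; rewrite !nmulA yf0 nmul0r.
exists (ed e ** b); rewrite -[in RHS]bE !nmulA //.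
Qed.

Lemma sink_ghost_path_eq0 x p q v : (forall e, src e <> x) -> (size q < size p)%N ->
  ghost_mono K v p ** path_mono K x q = 0.
Proof.
move=> sink; elim: p q => [|e p IHp] [|f q] //= lt_qp; rewrite -nmulA.
  by rewrite mul_ghost_vertex; case: eqP (sink e) => [->|_]; rewrite ?nmulr0.
rewrite (nmulA (gh e)) mul_ghost_edge; case: ifP => _; last by rewrite nmul0r nmulr0.
rewrite mul_vertex_path; case: ifP => _; last by rewrite nmulr0.
exact: IHp.
Qed.

Lemma vertex_single_edge e : (forall e', src e' = src e -> e' = e) ->
  vx (src e) = ed e ** gh e.
Proof.
move=> single; have emE : emits (src e) = [set e].
  by apply/seteqP; split=> [e' /single|e' ->].
have reg : regular (src e) by rewrite /regular emE; split; [exists e | exact: finite_set1].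
by rewrite (regular_vertexE _ reg) emE fset_set1 big_seq_fset1.
Qed.

(** Below an unbranched vertex the relation [v = e e^*] can be iterated until
    the path is as long as desired or stops at a sink. *)
Lemma unbranched_long_path m u : unbranched u -> exists x q,
  path_mono K x q ** ghost_mono K x q = vx u /\
  ((m <= size q)%N \/ forall e, src e <> x).
Proof.
elim: m u => [|m IHm] u nu.
  by exists u, [::]; rewrite /= mul_vertex_vertex eqxx; split=> //; left.
case: (pselect (exists e, src e = u)) => [[e eu]|none]; last first.
  exists u, [::]; rewrite /= mul_vertex_vertex eqxx; split=> //; right=> e eu.
  by apply: none; exists e.
have single e' : src e' = src e -> e' = e.
  move=> e'u; apply: contrapT => neq; apply: (nu u (reachable_refl u)).
  by exists e', e; rewrite e'u.
have [|x [q [qE qP]]] := IHm (rng e).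
  apply: (unbranched_reachable nu); rewrite -eu; exact/reachable_edge/reachable_refl.
exists x, (e :: q); rewrite -eu (vertex_single_edge single) /=; split=> //.
by rewrite -[LHS]nmulA (nmulA (path_mono _ _ _)) qE nmulA mul_edge_vertex eqxx.
Qed.

(** For a homogeneous [y] and a long path [q] from [u], the product [y q] is
    cancelled by some [b]; since [q q^* = u], [b] cancels [y u] as well. *)
Lemma unbranched_primitive u : unbranched u -> graded_primitive (vx u).
Proof.
move=> nu; split; first exact: deg_vertex.
- by rewrite mul_vertex_vertex eqxx.
- exact: lpa_vertex_neq0.
move=> n y y_deg yu; have [B BP] := homogeneous_cancel y_deg.
have [x [q [qE qP]]] := unbranched_long_path (\max_(g <- B) size g.2) nu.
have := BP x q (vx x); rewrite mul_path_vertex.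
case=> [g gB|y0|[b bE]].
- have [le_gq|lt_qg] := leqP (size g.2) (size q); [by left | right].
  case: qP => [le_mq|sink]; last exact: sink_ghost_path_eq0.
  by move: lt_qg; rewrite ltnNge (leq_trans _ le_mq) // (big_rem g) //= leq_maxl.
- by case: yu; rewrite -qE nmulA y0 nmul0r.
by exists b; rewrite -qE -[in RHS]bE !nmulA.
Qed.

Record primitive_decomposition u (s : seq L) : Prop := PrimitiveDecomposition {
  decomp_sum : vx u = \sum_(f <- s) f;
  decomp_primitive : forall f, f \in s -> graded_primitive f;
  decomp_vertexl : forall f, f \in s -> vx u ** f = f;
  decomp_vertexr : forall f, f \in s -> f ** vx u = f;
  decomp_orthogonal : forall f g, f \in s -> g \in s -> f <> g -> f ** g = 0
}.

Lemma unbranched_decomposition u : unbranched u -> primitive_decomposition u [:: vx u].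
Proof.
move=> nu; split=> [|f|f|f|f g]; first by rewrite big_seq1.
- by rewrite mem_seq1 => /eqP ->; exact: unbranched_primitive.
- by rewrite mem_seq1 => /eqP ->; rewrite mul_vertex_vertex eqxx.
- by rewrite mem_seq1 => /eqP ->; rewrite mul_vertex_vertex eqxx.
by rewrite !mem_seq1 => /eqP -> /eqP ->.
Qed.

(** The relation [u = sum e e^*] pushes a decomposition of the targets of the
    edges leaving [u] back to [u]. *)
Lemma primitive_decomposition_exists n u : row_finite E -> eventually_unbranched n u ->
  exists s, primitive_decomposition u s.
Proof.
move=> rf; elim: n u => [|n IHn] u nu.
  by exists [:: vx u]; apply: unbranched_decomposition; exact: (nu [::]).
case: (pselect (exists e, src e = u)) => [[e0 e0u]|none]; last first.
  exists [:: vx u]; apply: unbranched_decomposition => w [[|e p] [pP <-]].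
    by move=> [e [f [eu _ _]]]; apply: none; exists e.
  by move: pP; rewrite is_path_cons => /andP[/eqP eu _]; case: none; exists e.
have /choice[S SP] e : exists s, src e = u -> primitive_decomposition (rng e) s.
  case: (pselect (src e = u)) => [eu|neq]; last by exists [::].
  have [|s sP] := IHn (rng e); last by exists s.
  move=> p pP sz; apply: (nu (e :: p)) => //.
  by rewrite is_path_cons eu eqxx.
have reg : regular u by split; [exists e0 | exact: rf].
have mem_em e : (e \in fset_set (emits u)) -> src e = u.
  by rewrite in_fset_set; [rewrite inE | exact: rf].
pose T e := [seq ed e ** f ** gh e | f <- S e].
have memT f : f \in flatten [seq T e | e <- fset_set (emits u)] ->
    exists e g, [/\ src e = u, g \in S e & f = ed e ** g ** gh e].
  by move=> /flattenP[t /mapP[e /mem_em eu ->] /mapP[g gS ->]]; exists e, g.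
exists (flatten [seq T e | e <- fset_set (emits u)]); split.
- rewrite (regular_vertexE _ reg) big_flatten big_map big_seq [RHS]big_seq.
  apply: eq_bigr => e /mem_em eu; rewrite big_map.
  under eq_bigr do rewrite -nmulA.
  rewrite -nmul_sumr -nmul_suml -(decomp_sum (SP e eu)).
  by rewrite mul_vertex_ghost eqxx.
- move=> _ /memT[e [g [eu gS ->]]]; apply: graded_primitive_transport.
  + exact: (decomp_primitive (SP e eu)).
  + exact: (decomp_vertexr (SP e eu)).
  + exact: (decomp_vertexl (SP e eu)).
- by move=> _ /memT[e [g [eu gS ->]]]; rewrite !nmulA mul_vertex_edge eu eqxx.
- by move=> _ /memT[e [g [eu gS ->]]]; rewrite -nmulA mul_ghost_vertex eu eqxx.
move=> _ _ /memT[e [g [eu gS ->]]] /memT[e' [g' [e'u g'S ->]]] neq.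
rewrite -[ed e' ** _ ** _]nmulA !nmulA -(nmulA _ (gh e)) mul_ghost_edge.
case: (eqVneq e e') neq g'S => [<- neq g'S|_ _ _]; last by rewrite nmulr0 !nmul0r.
rewrite -[_ ** vx _]nmulA (decomp_vertexr (SP e eu) gS) -(nmulA (ed e)).
rewrite (decomp_orthogonal (SP e eu) gS g'S) ?nmulr0 ?nmul0r //.
by move=> gg'; apply: neq; rewrite gg'.
Qed.

(** The idempotents of the decompositions of all the vertices are pairwise
    orthogonal and generate the algebra as a left ideal; orthogonality makes
    the sum direct. *)
Lemma eventually_unbranched_semisimple : row_finite E ->
  (forall u, exists n, eventually_unbranched n u) -> graded_semisimple K E.
Proof.
move=> rf ev.
have /choice[S SP] u : exists s, primitive_decomposition u s.
  by have [n nu] := ev u; exact: primitive_decomposition_exists nu.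
pose P (f : L) := `[< exists u, f \in S u >].
pose I (f : {f : L | P f}) := [set a : L | a ** val f = a].
exists {f : L | P f}, I.
have primP (f : {f : L | P f}) : graded_primitive (val f).
  by have /asboolP[u fS] := valP f; exact: (decomp_primitive (SP u)).
have orth (f g : {f : L | P f}) : f != g -> val f ** val g = 0.
  move=> neq; have /asboolP[u fS] := valP f; have /asboolP[v gS] := valP g.
  case: (eqVneq u v) => [uv|uv].
    apply: (decomp_orthogonal (SP v)) => //; first by rewrite -uv.
    by move=> fg; case/eqP: neq; exact: val_inj.
  rewrite -(decomp_vertexr (SP u) fS) -(decomp_vertexl (SP v) gS).
  by rewrite nmulA -(nmulA (val f)) mul_vertex_vertex (negbTE uv) nmulr0 nmul0r.
split=> [f|]; first exact/graded_primitive_minimal/primP.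
have subg (f : {f : L | P f}) : is_subgroup (I f).
  by split=> [|a b af bf]; rewrite /I /= ?nmul0r // nmulBl af bf.
split.
  apply: (lpa_left_ideal_full (P := family_sum I)) => [a b||a b|v].
  - exact: (family_sumD subg).
  - exact: (family_sum0 subg).
  - move=> [s [h [s_uniq hP ->]]]; exists s, (fun i => a ** h i); split=> //.
      by move=> i; rewrite /I /= -nmulA hP.
    exact: nmul_sumr.
  rewrite (decomp_sum (SP v)) big_seq; apply: big_ind => [||f fS].
  - exact: (family_sum0 subg).
  - exact: (family_sumD subg).
  have Pf : P f by apply/asboolP; exists v.
  apply: (family_sum_mem subg (i := exist _ f Pf)).
  exact: (primitive_idem (decomp_primitive (SP v) fS)).
move=> s h s_uniq hP sum0 f fs.
have := congr1 (fun a => a ** val f) sum0.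
rewrite nmul_suml nmul0r (bigD1_seq f) //= hP.
rewrite big1 ?addr0 // => g gf.
by rewrite -(hP g) -nmulA orth ?nmulr0.
Qed.

End Primitive.

(** * Graded-simple modules over a semisimple algebra *)

Section GradedSimple.
Local Open Scope ring_scope.
Local Open Scope classical_set_scope.
Variables (R : nonUnitalRingType) (R_ : int -> set R).
Variables (M : fullModType R) (M_ : int -> set M).
Hypothesis grM : is_grading R_ M_.

Lemma grading0 n : M_ n 0.
Proof. by case: grM => sub _ _; case: (sub n). Qed.

Lemma grading_shift_independent (k : int) (s : seq int) (f : int -> M) : uniq s ->
    (forall n, n \in s -> M_ (n + k) (f n)) -> \sum_(n <- s) f n = 0 ->
  forall n, n \in s -> f n = 0.
Proof.
case: grM => _ [_ indep] _ s_uniq fP sum0 n ns.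
pose g i := if i - k \in s then f (i - k) else 0.
have gk i : i \in s -> g (i + k) = f i by move=> i_s; rewrite /g addrK i_s.
rewrite -gk //; apply: (indep [seq i + k | i <- s]).
- by rewrite map_inj_uniq // => i j /addIr.
- move=> i; rewrite /g; case: ifP => [/fP|_]; last exact: grading0.
  by rewrite subrK.
- by rewrite big_map -[RHS]sum0 !big_seq; apply: eq_bigr => i /gk.
exact: map_f.
Qed.

(** A graded submodule comes with a family of components indexed by all the
    degrees; setting it to [0] off the support leaves only the support to be
    examined. *)
Lemma graded_submodule_intro (N : set M) : is_submodule N ->
    (forall (s : seq int) (f : int -> M), uniq s -> (forall n, M_ n (f n)) ->
       N (\sum_(n <- s) f n) -> forall n, n \in s -> N (f n)) ->
  graded_submodule M_ N.
Proof.
move=> subN NP; split=> // x Nx; have [_ [span _] _] := grM.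
have [s [f [s_uniq fP xE]]] := span x.
have Nf n : n \in s -> N (f n) by apply: NP => //; rewrite -xE.
exists s, (fun n => if n \in s then f n else 0); split => //.
  move=> n; case: ifP => [/Nf//|_]; split; first exact: grading0.
  by case: subN => -[].
by rewrite xE !big_seq; apply: eq_bigr => n ->.
Qed.

Hypothesis R_full : forall a, family_sum R_ a.

(** The elements annihilated by [R] form a graded submodule, which is not [M]
    because [R M = M]. *)
Lemma graded_simple_act_neq0 (x : M) : graded_simple M_ -> x <> 0 ->
  exists a : R, a **: x <> 0.
Proof.
move=> [_ simp] x0; apply: contrapT => none.
have ax0 a : a **: x = 0 by apply: contrapT => ax; apply: none; exists a.
pose N := [set y : M | forall a : R, a **: y = 0].
have subN : is_submodule N.
  split; first split=> [a|y z Ny Nz a]; first exact: act0r.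
    by rewrite act_subr Ny Nz subrr.
  by move=> b y Ny a; rewrite actA Ny.
have grN : graded_submodule M_ N.
  apply: graded_submodule_intro => // s f s_uniq fP Ns n ns a.
  have [t [g [_ gP ->]]] := R_full a.
  rewrite act_suml big1 // => k _; case: (grM) => _ _ act_deg.
  apply: (grading_shift_independent (k := k) (f := fun n => g k **: f n) s_uniq) ns.
    by move=> m _; rewrite addrC; apply: act_deg; [exact: gP | exact: fP].
  by rewrite -act_sumr; exact: Ns.
have [N0|NT] := simp N grN.
  by apply: x0; have : N x := ax0; rewrite N0.
have [s xE] := act_full (R := R) x.
apply: x0; rewrite xE big1 // => p _.
by have Np : N p.2 by [rewrite NT]; exact: Np.
Qed.

(** When [b |-> b m] is a bijection from a left ideal [J] onto [M], a
    homomorphism [f] from [M] lifts along a surjection [g]: choose [a] with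
    [g a = f m] and send [b m] to [b a]. *)
Lemma cyclic_over_ideal_projective (J : set R) (m : M) :
    (forall a b, J a -> J b -> J (a - b)) -> (forall a b, J b -> J (a ** b)) ->
    (forall b, J b -> b **: m = 0 -> b = 0) ->
    (forall y, exists2 b, J b & y = b **: m) ->
  projective M.
Proof.
move=> JB JM inj surj A B g f [gD gM] g_surj [fD fM].
have [a ga] := g_surj (f m).
have [beta betaP] : {beta : M -> R | forall y, J (beta y) /\ y = beta y **: m}.
  have /choice[beta betaP] y : exists b, J b /\ y = b **: m.
    by have [b Jb yE] := surj y; exists b.
  by exists beta.
have betaE y b : J b -> y = b **: m -> beta y = b.
  move=> Jb yE; have [Jy yE'] := betaP y; apply/eqP; rewrite -subr_eq0; apply/eqP.
  by apply: inj; [exact: JB | rewrite act_subl -yE' -yE subrr].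
have JD b c : J b -> J c -> J (b + c).
  by move=> Jb Jc; rewrite -[c]opprK -(sub0r c); apply: (JB) => //; rewrite -(subrr c); apply: (JB) => //; exact: JB.
exists (fun y => beta y **: a); last first.
  by move=> y; have [_ yE] := betaP y; rewrite gM ga -fM -yE.
split=> [x y|c y].
  have [[Jx xE] [Jy yE]] := (betaP x, betaP y).
  by rewrite (betaE _ (beta x + beta y)) ?actDl //; [exact: JD | rewrite -xE -yE].
have [Jy yE] := betaP y.
by rewrite (betaE _ (c ** beta y)) ?actA //; [exact: JM | rewrite -actA -yE].
Qed.

Lemma projective_cyclic_fin_presented (m : M) :
  projective M -> (forall y, exists a : R, y = a **: m) -> fin_presented M.
Proof.
move=> projM gen.
have sub0 : is_submodule [set 0 : M].
  split; first by split=> // x y -> ->; rewrite subrr.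
  by move=> a x ->; rewrite /= act0r.
exists M, [set 0], sub0; split=> //.
- exists [:: m]; split=> // N [_ NM] Nm y _; have [a ->] := gen y.
  by apply: NM; apply: Nm; rewrite /= mem_head.
- by exists [::]; split=> [x|N [[N0 _] _] _ x ->].
exists (quot_proj sub0); split.
  by split=> [x y|a x]; [exact: quot_projD | symmetry; exact: quot_actE].
have /choice[r rP] q := quot_proj_surj (HN := sub0) q.
exists r => [x|q]; last by rewrite -rP.
have /quot_projP/= := rP (quot_proj sub0 x).
by move=> /eqP; rewrite subr_eq0 => /eqP.
Qed.

End GradedSimple.

(** Some minimal left ideal [I j] does not annihilate a homogeneous [m <> 0] of
    a graded-simple module; then [b |-> b m] is an isomorphism from [I j], by
    simplicity of both sides. *)
Lemma semisimple_fin_presented (K : fieldType) (E : graph) : graded_semisimple K E ->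
  forall (M : fullModType (lpa K E)) (M_ : int -> set M),
    is_grading (@lpa_deg K E) M_ -> graded_simple M_ -> fin_presented M.
Proof.
move=> [X [I [minI [spanI _]]]] M M_ grM simpM.
have full := @lpa_homogeneous_sum K E.
have [[x x0] simp] := simpM; have [_ [spanM _] degM] := grM.
have [d [m [md m0]]] : exists d m, M_ d m /\ m <> 0%R.
  have [s [f [_ fP xE]]] := spanM x; apply: contrapT => none; apply: x0.
  rewrite xE big1 // => n _; apply: contrapT => fn; apply: none.
  by exists n, (f n).
have [j [b0 [Ib0 b0m]]] : exists j b, I j b /\ act b m <> 0%R.
  have [a am] := graded_simple_act_neq0 grM full simpM m0.
  have [s [f [_ fP aE]]] := spanI a; apply: contrapT => none; apply: am.
  rewrite aE act_suml big1 // => i _; apply: contrapT => fi; apply: none.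
  by exists i, (f i).
have [[[[I0 IB] IM] grI] _ minj] := minI j.
have component s (f : int -> lpa K E) : uniq s -> (forall n, lpa_deg n (f n)) ->
    act (\sum_(n <- s) f n)%R m = 0%R -> forall n, n \in s -> act (f n) m = 0%R.
  move=> s_uniq fP sum0.
  apply: (grading_shift_independent grM (k := d) (f := fun n => act (f n) m) s_uniq).
    by move=> n _; apply: degM => //; exact: fP.
  by rewrite -act_suml.
have inj b : I j b -> act b m = 0%R -> b = 0%R.
  pose J := [set b | I j b /\ act b m = 0%R]%classic.
  have grJ : graded_left_ideal J.
    split; first split; first split=> [|a c [Ia am] [Ic cm]].
    - by split=> //; rewrite act0l.
    - by split; [exact: IB | rewrite act_subl am cm subrr].
    - by move=> a c [Ic cm]; split; [exact: IM | rewrite -actA cm act0r].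
    move=> c [Ic cm]; have [s [f [s_uniq fP cE]]] := grI c Ic.
    exists s, (fun n => if n \in s then f n else 0%R); split => //.
      move=> n; case: ifP => [ns|_]; last first.
        by split; [exact: deg_zero | split; rewrite ?act0l].
      have [fn In] := fP n; split=> //; split=> //.
      by apply: (component s) => //; [move=> i; case: (fP i) | rewrite -cE].
    by rewrite cE !big_seq; apply: eq_bigr => n ->.
  have [a []//|J0|JI] := minj J grJ.
    by move=> Ib bm; have : J b by [split]; rewrite J0.
  by case: b0m; have [] : J b0 by rewrite JI.
have surj y : exists2 b, I j b & y = act b m.
  pose N := [set y | exists2 b, I j b & y = act b m]%classic.
  have subN : is_submodule N.
    split; first split=> [|_ _ [a Ia ->] [c Ic ->]].
    - by exists 0%R; rewrite ?act0l.
    - by exists (a - c)%R; [exact: IB | rewrite act_subl].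
    - by move=> a _ [c Ic ->]; exists (nmul a c); [exact: IM | rewrite actA].
  have grN : graded_submodule M_ N.
    split=> // _ [c Ic ->]; have [s [f [s_uniq fP ->]]] := grI c Ic.
    exists [seq (n + d)%R | n <- s], (fun n => act (f (n - d)%R) m); split.
    - by rewrite map_inj_uniq // => i i' /addIr.
    - move=> n; have [fn In] := fP (n - d)%R; split; last by exists (f (n - d)%R).
      by rewrite -[X in M_ X](subrK d); exact: degM.
    by rewrite act_suml big_map; apply: eq_bigr => n _; rewrite addrK.
  have [N0|NT] := simp N grN; last by have : N y by rewrite NT.
  by case: b0m; have : N (act b0 m) by [exists b0]; rewrite N0.
apply: (projective_cyclic_fin_presented (m := m)).
  exact: (cyclic_over_ideal_projective IB IM inj surj).
by move=> y; have [b _ ->] := surj y; exists b.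
Qed.

(** * Graded-simple modules that are not finitely presented *)

Section DirectedAnnihilators.
Local Open Scope ring_scope.
Local Open Scope classical_set_scope.
Variables (K : fieldType) (E : graph).
Local Notation L := (lpa K E).
Local Notation vx := (@lpa_vertex K E).
Implicit Types (a b y : L).

Lemma lpa_is_grading : is_grading (@lpa_deg K E) (M := L) (@lpa_deg K E).
Proof.
split=> [n||m n a y ma ny].
- exact: lpa_deg_subgroup.
- split; first exact: lpa_homogeneous_sum.
  by move=> s f s_uniq fP; apply: lpa_deg_independent => // n _; exact: fP.
exact: deg_mul.
Qed.

Variables (I : Type) (u : vertex E) (z : I -> L) (d : I -> int) (i0 : I).

(** A family of nonzero homogeneous elements of [u L] whose left annihilators
    form a directed system.  The union [N] of the annihilators is a proper
    graded left ideal, and it is a maximal one by the last condition: a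
    homogeneous [y] outside of [N] satisfies [b y = u] modulo [N] for some
    [b]. *)
Record annihilator_system : Prop := AnnihilatorSystem {
  annsys_deg : forall i, lpa_deg (d i) (z i);
  annsys_neq0 : forall i, z i <> 0;
  annsys_vertex : forall i, vx u ** z i = z i;
  annsys_directed : forall i j, exists k, forall a,
    (a ** z i = 0 -> a ** z k = 0) /\ (a ** z j = 0 -> a ** z k = 0);
  annsys_cancel : forall n y, lpa_deg n y ->
    exists i, y ** z i = 0 \/ exists b, b ** (y ** z i) = z i
}.

Hypothesis sys : annihilator_system.

Definition eventual_annihilator : set L := [set a | exists i, a ** z i = 0].
Local Notation N := eventual_annihilator.

Lemma eventual_annihilator_submodule : is_submodule N.
Proof.
split; first split=> [|a b [i ai] [j bj]].
- by exists i0; rewrite nmul0r.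
- have [k kP] := annsys_directed sys i j; exists k.
  by rewrite nmulBl (kP a).1 // (kP b).2 // subrr.
by move=> a b [i bi]; exists i; rewrite -[_ **: _]/(a ** b) -nmulA bi nmulr0.
Qed.

Local Notation subN := eventual_annihilator_submodule.
Local Notation M := (quot_module subN).
Local Notation proj := (quot_proj subN).

Lemma quot_proj0 : proj 0 = 0.
Proof. by apply: (addrI (proj 0)); rewrite -quot_projD !addr0. Qed.

Lemma quot_projB a b : proj (a - b) = proj a - proj b.
Proof. by apply/eqP; rewrite eq_sym subr_eq -quot_projD subrK. Qed.

Lemma quot_proj_act a b : a **: proj b = proj (a ** b).
Proof. exact: quot_actE. Qed.

Lemma quot_proj_sum (J : Type) (s : seq J) (F : J -> L) :
  proj (\sum_(i <- s) F i) = \sum_(i <- s) proj (F i).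
Proof. exact: (big_morph _ (@quot_projD _ _ _ subN) quot_proj0). Qed.

Lemma quot_proj_eq0 a : proj a = 0 <-> N a.
Proof. by rewrite -quot_proj0 quot_projP subr0. Qed.

Definition quot_deg (n : int) : set M := [set q | exists2 a, lpa_deg n a & q = proj a].

Lemma quot_is_grading : is_grading (@lpa_deg K E) quot_deg.
Proof.
split=> [n||m n a _ ma [b nb ->]]; last first.
  by exists (a ** b); [exact: deg_mul | exact: quot_proj_act].
- split=> [q|s f s_uniq fP sum0 n ns].
    have [a ->] := quot_proj_surj q.
    have [s [f [s_uniq fP ->]]] := lpa_homogeneous_sum a.
    exists s, (fun n => proj (f n)); split=> //; last exact: quot_proj_sum.
    by move=> n; exists (f n); first exact: fP.
  have /choice[g gP] k : exists a, lpa_deg k a /\ f k = proj a.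
    by have [a ka ->] := fP k; exists a.
  have : proj (\sum_(k <- s) g k) = 0.
    by rewrite quot_proj_sum -[RHS]sum0; apply: eq_bigr => k _; rewrite (gP k).2.
  move=> /quot_proj_eq0[i]; rewrite nmul_suml => gz0.
  rewrite (gP n).2; apply/quot_proj_eq0; exists i.
  apply: (grading_shift_independent lpa_is_grading (k := d i)
    (f := fun k => g k ** z i) s_uniq) ns => // k _.
  by apply: deg_mul; [exact: (gP k).1 | exact: annsys_deg].
split; first by exists 0; [exact: deg_zero | rewrite quot_proj0].
move=> _ _ [a na ->] [b nb ->]; exists (a - b); last by rewrite quot_projB.
by apply: deg_add => //; exact: lpa_degN.
Qed.

Lemma eventual_annihilator_vertex a : N (a - a ** vx u).
Proof. by exists i0; rewrite nmulBl -nmulA (annsys_vertex sys) subrr. Qed.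

Lemma quot_graded_simple : graded_simple quot_deg.
Proof.
split.
  exists (proj (vx u)) => /quot_proj_eq0[i].
  by rewrite (annsys_vertex sys); exact: annsys_neq0 sys i.
move=> N' grN'; case: (pselect (N' = [set 0])); [by left | move=> N'0; right].
have [n [q [[y y_deg ->] Ny y0]]] := graded_submodule_homogeneous grN' N'0.
have [[_ actN'] _] := grN'.
have projuN' : N' (proj (vx u)).
  have [i [yz|[b bE]]] := annsys_cancel sys y_deg.
    by case: y0; apply/quot_proj_eq0; exists i.
  suff -> : proj (vx u) = b **: proj y by exact: actN'.
  rewrite quot_proj_act; apply/quot_projP; exists i.
  by rewrite nmulBl (annsys_vertex sys) -nmulA bE subrr.
apply/seteqP; split=> // q' _; have [a ->] := quot_proj_surj q'.
suff -> : proj a = a **: proj (vx u) by exact: actN'.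
rewrite quot_proj_act; apply/quot_projP; exact: eventual_annihilator_vertex.
Qed.

(** Schanuel's argument: a finite presentation [P / N'] of the quotient is
    compared with the projection of [L] onto it.  Lifting the presentation to
    [h : P -> L] and the image of [u] to [t] in [P], every [a] of the union is
    the sum of [h (a t)] and of a multiple of [u - h t], up to [L (1 - u)];
    the finitely many elements that matter lie in one annihilator. *)
Lemma fin_presented_annihilator_stable : fin_presented M ->
  exists i, forall j a, a ** z j = 0 -> a ** z i = 0.
Proof.
move=> [P [N' [subN' [projP _ [s [sN' spanN'] [psi [[psiD psiM] [phi psiK phiK]]]]]]]].
pose pr : P -> M := fun p => phi (quot_proj subN' p).
have psi_inj := can_inj psiK.
have prhom : is_hom pr.
  split=> [p q|a p]; apply: psi_inj; rewrite ?psiD ?psiM !phiK ?quot_projD //.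
  by symmetry; exact: quot_actE.
have projhom : is_hom (proj : L -> M).
  by split=> [a b|a b]; [exact: quot_projD | rewrite quot_proj_act].
have [|h [hD hM] hP] := projP _ _ _ _ projhom _ prhom.
  by move=> q; have [a ->] := quot_proj_surj q; exists a.
have psi0 : psi 0 = 0 by apply: (addrI (psi 0)); rewrite -psiD !addr0.
have pr0 p : pr p = 0 <-> N' p.
  have q0 : quot_proj subN' 0 = 0.
    by apply: (addrI (quot_proj subN' 0)); rewrite -quot_projD !addr0.
  split=> [p0|Np].
    have : quot_proj subN' p = quot_proj subN' 0 by rewrite q0 -psi0 -p0 phiK.
    by move/quot_projP; rewrite subr0.
  apply: psi_inj; rewrite psi0 phiK -q0; apply/quot_projP; by rewrite subr0.
have [t tE] : exists t, pr t = proj (vx u).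
  have [t tE] := quot_proj_surj (psi (proj (vx u))).
  by exists t; rewrite /pr -tE psiK.
have h0 : h 0 = 0 by apply: (addrI (h 0)); rewrite -hD !addr0.
have hB p q : h (p - q) = h p - h q.
  by apply/eqP; rewrite eq_sym subr_eq -hD subrK.
have common (r : seq L) : (forall a, a \in r -> N a) ->
    exists i, forall a, a \in r -> a ** z i = 0.
  elim: r => [|a r IHr] rN; first by exists i0.
  have [j aj] := rN a (mem_head _ _).
  have [|k kP] := IHr; first by move=> b br; apply: rN; rewrite inE br orbT.
  have [l lP] := annsys_directed sys j k; exists l => b.
  rewrite inE => /orP[/eqP ->|/kP bk]; first by case: (lP a) => + _; exact.
  by case: (lP b) => _; exact.
have [i iP] : exists i, forall a, a \in (vx u - h t) :: map h s -> a ** z i = 0.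
  apply: common => a; rewrite inE => /orP[/eqP ->|/mapP[p ps ->]].
    by apply/(quot_projP subN); rewrite hP tE.
  by apply/quot_proj_eq0; rewrite hP; apply/pr0; exact: sN'.
have hN' p : N' p -> h p ** z i = 0.
  apply: (spanN' [set p | h p ** z i = 0]) => [|q qs]; last first.
    by apply: iP; rewrite inE map_f ?orbT.
  split; first split=> [|p' q /= hp hq]; first by rewrite /= h0 nmul0r.
    by rewrite hB nmulBl hp hq subrr.
  by move=> a p' /= hp; rewrite hM -[_ **: _]/(a ** h p') -nmulA hp nmulr0.
exists i => j a aj.
have /hN' : N' (a **: t).
  apply/pr0; have [_ prM] := prhom; rewrite prM tE quot_proj_act.
  apply/quot_proj_eq0; exists j.
  by rewrite -nmulA (annsys_vertex sys).
rewrite hM -[_ **: _]/(a ** h t) -nmulA => aht.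
have := iP _ (mem_head _ _); rewrite nmulBl => /(congr1 (nmul a)).
by rewrite nmulr0 nmulBr aht subr0 (annsys_vertex sys).
Qed.

End DirectedAnnihilators.

Section GraphCondition.
Local Open Scope ring_scope.
Local Open Scope classical_set_scope.
Variables (K : fieldType) (E : graph).
Local Notation L := (lpa K E).
Local Notation vx := (@lpa_vertex K E).
Local Notation ed := (@lpa_edge K E).
Local Notation gh := (@lpa_ghost K E).

Hypothesis simple_fp : forall (M : fullModType L) (M_ : int -> set M),
  is_grading (@lpa_deg K E) M_ -> graded_simple M_ -> fin_presented M.

Lemma annihilator_system_stable (I : Type) u (z : I -> L) d (i0 : I) :
  annihilator_system u z d ->
  exists i, forall j a, a ** z j = 0 -> a ** z i = 0.
Proof.
move=> sys; apply: (fin_presented_annihilator_stable (i0 := i0) (sys := sys)).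
exact: simple_fp (quot_is_grading i0 sys) (quot_graded_simple i0 sys).
Qed.

(** The product of the [v - v e e^*] over [F], that is [v - sum e e^*] over the
    edges in [F] leaving [v].  As a product it is defined for lists with
    repetitions. *)
Definition edge_complement v (F : seq (edge E)) : L :=
  foldr (fun e a => vx v ** (a - ed e ** (gh e ** a))) (vx v) F.

Lemma edge_complement_deg v F : lpa_deg 0 (edge_complement v F).
Proof.
elim: F => [|e F IHF]; first exact: deg_vertex.
apply: (deg_mul (m := 0) (n := 0)); first exact: deg_vertex.
apply: deg_add => //; apply: lpa_degN.
exact: (deg_mul (deg_edge K e) (deg_mul (deg_ghost K e) IHF)).
Qed.

Lemma edge_complement_vertex v F : vx v ** edge_complement v F = edge_complement v F.
Proof. by case: F => [|e F] /=; rewrite ?nmulA mul_vertex_vertex eqxx. Qed.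

Lemma ghost_edge_complement v F e : e \in F -> gh e ** edge_complement v F = 0.
Proof.
elim: F => [|f F IHF] //; rewrite inE /= nmulA mul_ghost_vertex.
case: ifP => _; last by rewrite nmul0r.
rewrite nmulBr nmulA mul_ghost_edge; case: eqVneq => [-> _|_ /= /IHF ->].
  by rewrite nmulA mul_vertex_ghost eqxx subrr.
by rewrite nmul0r subr0.
Qed.

Lemma ghost_edge_complement_notin v F e : src e = v -> e \notin F ->
  gh e ** edge_complement v F = gh e.
Proof.
move=> ev; elim: F => [|f F IHF] /=; first by rewrite mul_ghost_vertex ev eqxx.
rewrite inE negb_or => /andP[ef eF]; rewrite nmulA mul_ghost_vertex ev eqxx.
by rewrite nmulBr IHF // nmulA mul_ghost_edge (negbTE ef) nmul0r subr0.
Qed.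

Lemma edge_complement_absorb v F (a : L) : vx v ** a = a ->
  (forall e, e \in F -> gh e ** a = 0) -> edge_complement v F ** a = a.
Proof.
move=> va; elim: F => [|e F IHF] //= Fa; rewrite -nmulA nmulBl -!nmulA.
rewrite IHF => [|f fF]; last by apply: Fa; rewrite inE fF orbT.
by rewrite Fa ?mem_head // nmulr0 subr0.
Qed.

(** At an infinite emitter [v] the quotient is the module spanned by the paths
    ending at [v]; finitely many relations involve finitely many of the edges
    leaving [v]. *)
Lemma simple_fp_row_finite : row_finite E.
Proof.
move=> v; apply: contrapT => v_inf.
have absorb F G : {subset F <= G} ->
    edge_complement v F ** edge_complement v G = edge_complement v G.
  move=> FG; apply: edge_complement_absorb; first exact: edge_complement_vertex.
  by move=> e /FG; exact: ghost_edge_complement.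
have fresh (F : seq (edge E)) : exists2 e, src e = v & e \notin F.
  apply: contrapT => none; apply: v_inf.
  apply: (@sub_finite_set _ _ [set` F]); last exact: finite_seq.
  by move=> e ev; apply: contrapT => /negP eF; apply: none; exists e.
have sys : annihilator_system v (edge_complement v) (fun=> 0).
  split=> [F|F|F|F G|n y y_deg].
  - exact: edge_complement_deg.
  - have [e ev eF] := fresh F; move=> F0; apply: (@lpa_ghost_neq0 K E e).
    by rewrite -(ghost_edge_complement_notin ev eF) F0 nmulr0.
  - exact: edge_complement_vertex.
  - exists (F ++ G) => a; split=> aE.
      by rewrite -(absorb F) ?nmulA ?aE ?nmul0r // => e; rewrite mem_cat => ->.
    by rewrite -(absorb G) ?nmulA ?aE ?nmul0r // => e; rewrite mem_cat orbC => ->.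
  have [B BP] := homogeneous_cancel y_deg.
  (* With the first edges of the nontrivial ghost paths of [y] removed from
     [v], only the trivial ghost path acts on what remains. *)
  exists (flatten [seq take 1 g.2 | g <- B]).
  set F := flatten _.
  have := BP v [::] (edge_complement v F); rewrite /= edge_complement_vertex.
  apply=> -[x [|e q]] gB; [by left | right].
  rewrite /= -nmulA ghost_edge_complement ?nmulr0 //.
  apply/flattenP; exists [:: e]; last exact: mem_head.
  by apply/mapP; exists (x, e :: q); rewrite //= take0.
have [F FP] := annihilator_system_stable [::] sys.
have [e ev eF] := fresh F; apply: (@lpa_ghost_neq0 K E e).
rewrite -(ghost_edge_complement_notin ev eF); apply: (FP (e :: F)).
exact/ghost_edge_complement/mem_head.
Qed.

(** Let [z n] be the first [n] steps of an infinite path [e]; the quotient is a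
    graded version of the module spanned by the infinite paths sharing a tail
    with [e].  If [e] bifurcates after [m] steps, an edge [h] leaving it there
    gives the element [h^* (z m)^*], which kills [z m.+1] but not [z m], so
    that the annihilators do not stabilize. *)
Lemma simple_fp_eventually_unbranched (u : vertex E) : exists n, eventually_unbranched n u.
Proof.
apply: contrapT => none.
have [|e [e0u erng ebif]] := @infinite_branching_path E u simple_fp_row_finite.
  by move=> n un; apply: none; exists n.
pose z n := path_mono K (src (e n)) (mkseq e n).
have zS n : z n.+1 = z n ** ed (e n).
  rewrite /z mkseqS -cats1 -[ed (e n)](_ : path_mono K (src (e n.+1)) [:: e n] = _).
    by rewrite mul_path_path /= eqxx.
  by rewrite /= mul_edge_vertex erng eqxx.
have z_stays m n a : (m <= n)%N -> a ** z m = 0 -> a ** z n = 0.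
  move=> /subnKC <-; elim: (n - m)%N => [|k IHk] az; first by rewrite addn0.
  by rewrite addnS zS nmulA IHk ?nmul0r.
have z_ghost n : ghost_mono K (src (e n)) (mkseq e n) ** z n = vx (src (e n)).
  elim: n => [|n IHn]; first by rewrite /= mul_vertex_vertex eqxx.
  have -> : ghost_mono K (src (e n.+1)) (mkseq e n.+1) =
      gh (e n) ** ghost_mono K (src (e n)) (mkseq e n).
    by rewrite mul_ghost_ghost_mono eqxx mkseqS erng.
  rewrite zS -nmulA (nmulA _ (z n)) IHn mul_vertex_edge eqxx.
  by rewrite mul_ghost_edge eqxx erng.
have sys : annihilator_system u z (fun n => n%:Z).
  split=> [n|n zn0|n|i j|n y y_deg].
  - elim: n => [|n IHn]; first exact: deg_vertex.
    by rewrite zS -addn1 PoszD; apply: deg_mul => //; exact: deg_edge.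
  - apply: (@lpa_vertex_neq0 K E (src (e n))).
    by rewrite -z_ghost zn0 nmulr0.
  - by rewrite /z mul_vertex_path; case: n => [|n] /=; rewrite e0u eqxx.
  - by exists (maxn i j) => a; split; apply: z_stays; rewrite ?leq_maxl ?leq_maxr.
  have [B BP] := homogeneous_cancel y_deg.
  exists (\max_(g <- B) size g.2)%N; set m := (\max_(g <- B) _)%N.
  have := BP (src (e m)) (mkseq e m) (vx (src (e m))); rewrite mul_path_vertex.
  by apply=> g gB; left; rewrite size_mkseq /m (big_rem g) //= leq_maxl.
have [n nP] := annihilator_system_stable 0%N sys.
have [m le_nm [f [g [fm gm fg]]]] := ebif n.
have [h hm hneq] : exists2 h, src h = src (e m) & h <> e m.
  by case: (eqVneq f (e m)) => [fe|/eqP fe]; [exists g => // ge; apply: fg; rewrite fe ge | exists f].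
pose a := gh h ** ghost_mono K (src (e m)) (mkseq e m).
have azm : a ** z m = gh h by rewrite -nmulA z_ghost mul_ghost_vertex hm eqxx.
apply: (@lpa_ghost_neq0 K E h); rewrite -azm; apply: (z_stays n) => //.
apply: (nP m.+1); rewrite zS nmulA azm mul_ghost_edge.
by case: eqP.
Qed.

End GraphCondition.

Theorem theorem4p5 (K : fieldType) (E : graph) :
  ((forall (M : fullModType (lpa K E)) (M_ : int -> set M),
      is_grading (@lpa_deg K E) M_ -> graded_simple M_ -> fin_presented M)
   <-> graded_semisimple K E)
  /\
  (graded_semisimple K E
   <-> row_finite E /\
       forall u : vertex E, exists n : nat, forall p : seq (edge E),
         is_path u p -> (n <= size p)%N ->
         line_point (path_end u p) \/ laurent_vertex (path_end u p)).
Proof.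
have graph_of_simple : (forall (M : fullModType (lpa K E)) (M_ : int -> set M),
      is_grading (@lpa_deg K E) M_ -> graded_simple M_ -> fin_presented M) ->
    row_finite E /\ forall u : vertex E, exists n, eventually_unbranched n u.
  move=> fp; split; first exact: simple_fp_row_finite fp.
  exact: simple_fp_eventually_unbranched fp.
split; split.
- by move=> /graph_of_simple[rf ev]; exact: eventually_unbranched_semisimple.
- exact: semisimple_fin_presented.
- move=> /semisimple_fin_presented/graph_of_simple[rf ev]; split=> // u.
  by have [n nu] := ev u; exists n => p pP sz; exact/unbranchedP/nu.
move=> [rf ev]; apply: eventually_unbranched_semisimple => // u.
by have [n nu] := ev u; exists n => p pP sz; apply/unbranchedP; exact: nu.
Qed.
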